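(* Let $P_c=P+c$ $(c\in\mathbb{C})$ be an admissible family of Laurent polynomials in $n$ variables with critical image $K\subset\mathbb{C}$, let $c(\tau)$ be a holomorphic function on the upper half-plane $\mathbb{H}$, set $V=\{\tau\in\mathbb{H}:c(\tau)\notin K\}$, and let $F(\tau)=\nu\,\mathrm{m}(P_{c(\tau)})$ for $\tau\in\mathbb{H}$, where $\nu>0$ is a constant (the normalization factor of the family). Let $E(\tau)$ be holomorphic on $\mathbb{H}$, set $G:=\operatorname{Re}E$, and suppose $F=G$ on a nonempty open subset of a connected component $W$ of $V$. Then $$F(\tau)=G(\tau)\qquad\text{for every }\tau\in\overline{W}\cap\mathbb{H}.$$
   Context: For a nonzero Laurent polynomial $P$ in $n$ variables, $\mathrm{m}(P)=\int_{\mathbb{T}^n}\log|P|\,d\mu$ is the logarithmic Mahler measure, where $\mathbb{T}^n=\{|x_1|=\dots=|x_n|=1\}$ and $\mu$ is normalized Haar measure on $\mathbb{T}^n$. An admissible family is a family $P_c=P+c$, $c\in\mathbb{C}$, with $P$ a fixed Laurent polynomial in $x_1,\dots,x_n$, such that $c\mapsto\mathrm{m}(P_c)$ is continuous (real-valued) on all of $\mathbb{C}$. A critical image of the family is any closed set $K\subset\mathbb{C}$ containing $-P(\mathbb{T}^n):=\{-P(x):x\in\mathbb{T}^n\}$. *)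

(* Defs.v *)
From HB Require Import structures.
From mathcomp Require Import all_boot all_order all_algebra.
From mathcomp Require Import finmap.
From mathcomp Require Import complex.
From mathcomp Require Import all_classical all_reals all_analysis.

Set Implicit Arguments.
Unset Strict Implicit.
Unset Printing Implicit Defensive.

Import Order.TTheory GRing.Theory Num.Theory.
Import numFieldNormedType.Exports.
Local Open Scope classical_set_scope.
Local Open Scope ring_scope.

(* The topology and the complex normed module structure of R[i] that come from
   its absolute value. The library attaches them to R[i]^o, but not to R[i]. *)
HB.instance Definition _ (R : realType) :=
  PseudoPointedMetric.copy R[i] R[i]^o.
HB.instance Definition _ (R : realType) := NormedModule.copy R[i] R[i]^o.

(* Laurent polynomials in n variables with coefficients in A: finitely
   supported families of coefficients indexed by the exponents k in Z^n. *)
Notation laurent A n := {fsfun 'rV[int]_n -> A with 0}.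

Definition laurent_eval (R : realType) (n : nat) (P : laurent R[i] n)
    (x : 'rV[R[i]]_n) : R[i] :=
  \sum_(k <- finsupp P) P k * \prod_(j < n) x 0 j ^ k 0 j.

Definition laurent_addC (R : realType) (n : nat) (P : laurent R[i] n)
    (c : R[i]) : laurent R[i] n :=
  [fsfun P with 0 |-> P 0 + c].

Definition torus (R : realType) (n : nat) : set 'rV[R[i]]_n :=
  [set x | forall j, `|x 0 j| = 1].

Definition borelC (R : realType) (n : nat) :=
  g_sigma_algebraType (@open 'rV[R[i]]_n).

(* The normalized Haar measure of the torus, seen as a Borel probability
   measure on C^n that is carried by the torus: it is invariant under the
   multiplication by each point of the torus. *)
Definition normalized_haar (R : realType) (n : nat)
    (mu : probability (borelC R n) R) : Prop :=
  mu (@torus R n) = 1%E /\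
  forall (u : 'rV[R[i]]_n) (A : set (borelC R n)), torus u -> measurable A ->
    mu [set x : 'rV[R[i]]_n | A (map2_mx *%R u x)] = mu A.

(* Since lne 0 = -oo, the value is -oo at P = 0. *)
Definition mahler (R : realType) (n : nat) (mu : probability (borelC R n) R)
    (P : laurent R[i] n) : \bar R :=
  (\int[mu]_(x in @torus R n) lne (complex.Re `|laurent_eval P x|)%:E)%E.

Definition admissible (R : realType) (n : nat)
    (mu : probability (borelC R n) R) (P : laurent R[i] n) : Prop :=
  (forall c, mahler mu (laurent_addC P c) \is a fin_num) /\
  continuous (fun c => fine (mahler mu (laurent_addC P c))).

Definition critical_image (R : realType) (n : nat) (P : laurent R[i] n)
    (K : set R[i]) : Prop :=
  closed K /\ [set - laurent_eval P x | x in @torus R n] `<=` K.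

Definition upper_half_plane (R : realType) : set R[i] :=
  [set z | 0 < complex.Im z].

(* For D open: complex differentiability at each point of D. *)
Definition holomorphic_on (R : realType) (D : set R[i]) (f : R[i] -> R[i]) :
    Prop :=
  forall z, D z -> derivable f z 1.

Lemma laurent_eval_addC (R : realType) (n : nat) (P : laurent R[i] n)
    (c : R[i]) (x : 'rV[R[i]]_n) :
  laurent_eval (laurent_addC P c) x = laurent_eval P x + c.
Proof.
set M := fun k : 'rV[int]_n => \prod_(j < n) x 0 j ^ k 0 j.
pose S := (0 |` finsupp P)%fset.
have evalE (Q : laurent R[i] n) : (finsupp Q `<=` S)%fset ->
    laurent_eval Q x = \sum_(k <- S) Q k * M k.
  move=> QS; rewrite /laurent_eval; apply: big_fset_incl => // k _ kQ.
  by rewrite fsfun_dflt ?mul0r.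
rewrite !evalE ?fsubsetU1 //; last first.
  rewrite finsupp_with; case: ifP => // _.
  exact: fsubset_trans (fsubD1set _ _) (fsubsetU1 _ _).
have S0 : 0 \in S by rewrite !inE eqxx.
rewrite (big_fsetD1 _ S0) [in RHS](big_fsetD1 _ S0) /= fsfun_with.
under eq_big_seq => k.
  rewrite !inE => /andP[k0 _]; rewrite fsfun_withE (negbTE k0). over.
have -> : M 0 = 1 by rewrite /M big1 // => j _; rewrite mxE expr0z.
by rewrite !mulr1 -addrA [c + _]addrC addrA.
Qed.

(* Main.v *)
Require Import Defs.
From HB Require Import structures.
From mathcomp Require Import all_boot all_order all_algebra.
From mathcomp Require Import finmap.
From mathcomp Require Import complex.
From mathcomp Require Import all_classical all_reals all_analysis.
From mathcomp Require Import ring lra.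
Import Order.TTheory GRing.Theory Num.Theory.
Import numFieldNormedType.Exports.
Local Open Scope classical_set_scope.
Local Open Scope ring_scope.

(* Off the critical image, [log |P + c + s| = log |P + c| + Re Log (1 + s / (P + c))]
   on the torus for small [s], so integrating shows that [F] is locally on [V]
   the real part of a holomorphic function. By unique continuation the interior
   of [{F = G}] is relatively closed in [V], hence contains the component [W],
   and continuity of [F] and [G] gives the equality on the closure.

   Unique continuation needs no power series. If [f] vanishes on the left edge
   of a rectangle whose half-height exceeds its width, Cauchy-Goursat for
   [f z * exp (N (z - z0)^2)], with [z0] the midpoint of the right edge and
   [N] large, forces [f z0 = 0]. Applied in the coordinate [log (z - q)], this
   propagates the vanishing of [f] from a small disk around [q] to the largest
   one on which [f] is holomorphic. *)

Set Implicit Arguments.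
Unset Strict Implicit.
Unset Printing Implicit Defensive.

(** * Goursat's theorem for real 1-forms *)

Section Integral.
Context {R : realType}.
Implicit Types (f g : R -> R) (a b c m e : R).

(** Holomorphy is given only as complex differentiability at each point, so no continuity of
    derivatives may be used. This is why closedness of the form [Re (f dz)] is a pointwise notion
    here and why Goursat's subdivision carries the proof. The unknown is an identity between real
    parts, whereas the rectangle argument treats a complex [f] that vanishes. The passage between
    the two: a function whose real part vanishes near a point has derivative zero there, so it is an
    imaginary constant nearby, and this constant is subtracted before continuing. In the rectangle,
    the left edge is the only side where the Gaussian may be huge, up to [exp (N a^2)]; the
    vanishing of [f] on that edge removes exactly this contribution. *)

Definition integ f a b : R := \int[@lebesgue_measure R]_(t in `[a, b]) f t.

Definition cont_on f a b := forall t, a <= t <= b -> {for t, continuous f}.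

Lemma cont_onS f a b a' b' : cont_on f a b -> a <= a' -> b' <= b ->
  cont_on f a' b'.
Proof. by move=> cf aa bb t /andP[at' tb]; apply: cf; lra. Qed.

Lemma cont_onB f g a b : cont_on f a b -> cont_on g a b ->
  cont_on (fun t => f t - g t) a b.
Proof. by move=> cf cg t tab; apply: continuousB; [exact: cf|exact: cg]. Qed.

Lemma cont_on_within f a b : cont_on f a b -> {within `[a, b], continuous f}.
Proof.
move=> cf; apply: continuous_in_subspaceT => t /set_mem /=.
by rewrite in_itv /= => /cf.
Qed.

Lemma cont_on_integrable f a b : cont_on f a b ->
  (@lebesgue_measure R).-integrable `[a, b] (EFin \o f).
Proof.
move=> cf; apply: continuous_compact_integrable; first exact: segment_compact.
exact: cont_on_within.
Qed.

Lemma integ_cst c a b : a <= b -> integ (fun=> c) a b = c * (b - a).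
Proof.
move=> ab; rewrite /integ Rintegral_cst //= lebesgue_measure_itv /= lte_fin.
by case: ltgtP ab => //= ->; rewrite subrr.
Qed.

Lemma cont_on_cst c a b : cont_on (fun=> c) a b.
Proof. by move=> t _; exact: cst_continuous. Qed.

Lemma integ_ge f a b c : a <= b -> cont_on f a b ->
  (forall t, a <= t <= b -> c <= f t) -> c * (b - a) <= integ f a b.
Proof.
move=> ab cf h; rewrite -integ_cst //; apply: le_Rintegral => //.
- exact: (@cont_on_integrable (fun=> c) a b (@cont_on_cst c a b)).
- exact: cont_on_integrable.
Qed.

Lemma integ_le f a b c : a <= b -> cont_on f a b ->
  (forall t, a <= t <= b -> f t <= c) -> integ f a b <= c * (b - a).
Proof.
move=> ab cf h; rewrite -integ_cst //; apply: le_Rintegral => //.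
- exact: cont_on_integrable.
- exact: (@cont_on_integrable (fun=> c) a b (@cont_on_cst c a b)).
Qed.

Lemma integ_approx f a b m e : a <= b -> cont_on f a b ->
  (forall t, a <= t <= b -> `|f t - m| <= e) ->
  `|integ f a b - m * (b - a)| <= e * (b - a).
Proof.
move=> ab cf h; have lo : (m - e) * (b - a) <= integ f a b.
  by apply: integ_ge => // t /h; rewrite ler_norml; lra.
have hi : integ f a b <= (m + e) * (b - a).
  by apply: integ_le => // t /h; rewrite ler_norml; lra.
by rewrite ler_norml; lra.
Qed.

Lemma integ_split f a b c : a <= c -> c <= b -> cont_on f a b ->
  integ f a b = integ f a c + integ f c b.
Proof.
move=> ac cb cf; have if_ := cont_on_integrable cf.
have := @Rintegral_itvB R f (BLeft a) (BRight b) c if_.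
rewrite !bnd_simp => /(_ ac cb) h.
have if' : (@lebesgue_measure R).-integrable `]c, b] (EFin \o f).
  by apply: integrableS if_ => //= t /=; rewrite !in_itv /=; lra.
by move: h; rewrite (Rintegral_itv_obnd_cbnd if') /integ => <-; rewrite addrC subrK.
Qed.

Lemma integB f g a b : cont_on f a b -> cont_on g a b ->
  integ (fun t => f t - g t) a b = integ f a b - integ g a b.
Proof. by move=> cf cg; apply: RintegralB => //; exact: cont_on_integrable. Qed.

Lemma integ0 f a b : (forall t, a <= t <= b -> f t = 0) -> integ f a b = 0.
Proof.
move=> h; rewrite /integ (@eq_Rintegral _ _ _ _ _ (cst 0)).
  by rewrite Rintegral_cst //= mul0r.
by move=> t /set_mem /=; rewrite in_itv /= => /h.
Qed.

End Integral.

(** * Closed forms on rectangles and Goursat's subdivision *)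

Section Goursat.
Context {R : realType}.
Implicit Types (p q : R -> R -> R).

Definition has_diff2 p (x y a b : R) :=
  forall e, 0 < e -> exists2 d, 0 < d & forall h k, `|h| < d -> `|k| < d ->
    `|p (x + h) (y + k) - p x y - a * h - b * k| <= e * (`|h| + `|k|).

Lemma has_diff2_cont p x y a b : has_diff2 p x y a b ->
  {for x, continuous (p ^~ y)} /\ {for y, continuous (p x)}.
Proof.
move=> dp; have [d d0 hd] := dp _ ltr01.
pose M := `|a| + `|b| + 1.
have M0 : 0 < M by rewrite /M; have := normr_ge0 a; have := normr_ge0 b; lra.
have key h k : `|h| < d -> `|k| < d ->
    `|p (x + h) (y + k) - p x y| <= M * (`|h| + `|k|).
  move=> hh hk; have := hd _ _ hh hk.
  set D := _ - p x y => H.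
  have -> : D = (D - a * h - b * k) + (a * h + b * k) by ring.
  apply: le_trans (ler_normD _ _) _.
  apply: le_trans (lerD H (ler_normD _ _)) _; rewrite !normrM /M.
  have := normr_ge0 a; have := normr_ge0 b; have := normr_ge0 h.
  by have := normr_ge0 k; nra.
have gen (g : R -> R) t : (forall s, `|s| < d -> `|g (t + s) - g t| <= M * `|s|) ->
    {for t, continuous g}.
  move=> hg; apply/cvgrPdist_le => e e0.
  near=> s; rewrite distrC.
  have hs : `|s - t| < d.
    by near: s; apply/nbhs_ballP; exists d => //= z; rewrite /ball /= distrC.
  have := hg _ hs; rewrite subrKC => /le_trans; apply.
  rewrite -ler_pdivlMl // mulrC ltW //.
  near: s; apply/nbhs_ballP; exists (e / M); first exact: divr_gt0.
  by move=> z; rewrite /ball /= distrC.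
split; apply: gen => s hs.
  by have := key s 0 hs; rewrite normr0 !addr0; apply.
by have := key 0 s; rewrite normr0 addr0 add0r; apply.
Unshelve. all: by end_near. Qed.

(* The integral of [p dx + q dy] along the boundary, counterclockwise. *)
Definition circulation p q (x1 x2 y1 y2 : R) : R :=
  integ (fun x => p x y1 - p x y2) x1 x2 +
  integ (fun y => q x2 y - q x1 y) y1 y2.

(* Closedness is pointwise: the shared [b] says [dp/dy = dq/dx]. *)
Definition closed_on p q (x1 x2 y1 y2 : R) :=
  forall x y, x1 <= x <= x2 -> y1 <= y <= y2 ->
    exists a b c, has_diff2 p x y a b /\ has_diff2 q x y b c.

Section fixed_form.
Variables (p q : R -> R -> R).

Lemma closed_onS x1 x2 y1 y2 x1' x2' y1' y2' : closed_on p q x1 x2 y1 y2 ->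
  x1 <= x1' -> x2' <= x2 -> y1 <= y1' -> y2' <= y2 ->
  closed_on p q x1' x2' y1' y2'.
Proof. by move=> H ? ? ? ? x y /andP[? ?] /andP[? ?]; apply: H; lra. Qed.

Lemma closed_on_cont x1 x2 y1 y2 : closed_on p q x1 x2 y1 y2 ->
  (forall y, y1 <= y <= y2 -> cont_on (p ^~ y) x1 x2) /\
  (forall x, x1 <= x <= x2 -> cont_on (q x) y1 y2).
Proof.
move=> H; split=> s hs t ht.
  by have [a [b [c [/has_diff2_cont[] ? ?]]]] := H t s ht hs.
by have [a [b [c [_ /has_diff2_cont[]]]]] := H s t hs ht.
Qed.

Lemma circulation_splitx x1 x2 y1 y2 m : x1 <= m -> m <= x2 -> y1 <= y2 ->
  closed_on p q x1 x2 y1 y2 -> circulation p q x1 x2 y1 y2 =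
  circulation p q x1 m y1 y2 + circulation p q m x2 y1 y2.
Proof.
move=> xm mx yy /closed_on_cont[cp cq]; rewrite /circulation.
rewrite (integ_split xm mx); last by apply: cont_onB; apply: cp; lra.
rewrite !integB; try (by apply: cq; lra);
  try by (move=> t ht; apply: cp; lra).
ring.
Qed.

Lemma circulation_splity x1 x2 y1 y2 m : y1 <= m -> m <= y2 -> x1 <= x2 ->
  closed_on p q x1 x2 y1 y2 -> circulation p q x1 x2 y1 y2 =
  circulation p q x1 x2 y1 m + circulation p q x1 x2 m y2.
Proof.
move=> xm mx yy /closed_on_cont[cp cq]; rewrite /circulation.
rewrite [X in _ + X](integ_split xm mx); last by apply: cont_onB; apply: cq; lra.
rewrite !integB; try (by apply: cp; lra);
  try by (move=> t ht; apply: cq; lra).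
ring.
Qed.

(** For the affine approximations of [p] and [q] everything cancels: constants, [a] and [c] between
    opposite sides, and the remaining [- b * k * w] and [b * w * k] against each other because [b]
    is shared. Only the differentiability errors survive. *)
Lemma circulation_local x y a b c e : 0 < e ->
  has_diff2 p x y a b -> has_diff2 q x y b c ->
  exists2 d, 0 < d & forall x1 x2 y1 y2, x1 <= x <= x2 -> y1 <= y <= y2 ->
    x2 - x1 < d -> y2 - y1 < d -> closed_on p q x1 x2 y1 y2 ->
    `|circulation p q x1 x2 y1 y2| <= e * ((x2 - x1) + (y2 - y1)) ^+ 2.
Proof.
move=> e0 dp dq; have e2 : 0 < e / 2 by lra.
(* Half of [e] for each, since every integrand is a difference of two values. *)
have [d1 d10 h1] := dp _ e2; have [d2 d20 h2] := dq _ e2.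
exists (Num.min d1 d2); first by rewrite lt_min d10.
move=> x1 x2 y1 y2 /andP[xa xb] /andP[ya yb].
rewrite !lt_min => /andP[w1 w2] /andP[k1 k2] /closed_on_cont[cp cq].
set w := x2 - x1 in w1 w2 *; set k := y2 - y1 in k1 k2 *.
have w0 : 0 <= w by rewrite /w; lra.
have k0 : 0 <= k by rewrite /k; lra.
have xx : x1 <= x2 by lra.
have yy : y1 <= y2 by lra.
have near_x t : x1 <= t <= x2 -> `|t - x| <= w.
  by move=> ?; rewrite ler_norml /w; lra.
have near_y t : y1 <= t <= y2 -> `|t - y| <= k.
  by move=> ?; rewrite ler_norml /k; lra.
have ap u v : x1 <= u <= x2 -> y1 <= v <= y2 ->
    `|p u v - p x y - a * (u - x) - b * (v - y)| <= e / 2 * (w + k).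
  move=> /near_x hu /near_y hv.
  have := h1 (u - x) (v - y) (le_lt_trans hu w1) (le_lt_trans hv k1).
  rewrite !subrKC => /le_trans; apply.
  by rewrite ler_pM2l // lerD.
have aq u v : x1 <= u <= x2 -> y1 <= v <= y2 ->
    `|q u v - q x y - b * (u - x) - c * (v - y)| <= e / 2 * (w + k).
  move=> /near_x hu /near_y hv.
  have := h2 (u - x) (v - y) (le_lt_trans hu w2) (le_lt_trans hv k2).
  rewrite !subrKC => /le_trans; apply.
  by rewrite ler_pM2l // lerD.
have I1 : `|integ (fun t => p t y1 - p t y2) x1 x2 - (- b * k) * (x2 - x1)|
    <= e * (w + k) * (x2 - x1).
  apply: integ_approx => //.
    by apply: cont_onB; apply: cp; lra.
  move=> t ht; have := ap t y1 ht; have := ap t y2 ht.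
  rewrite !ler_norml /k => A1 A2.
  have {A1} := A1 ltac:(lra); have {A2} := A2 ltac:(lra); lra.
have I2 : `|integ (fun t => q x2 t - q x1 t) y1 y2 - (b * w) * (y2 - y1)|
    <= e * (w + k) * (y2 - y1).
  apply: integ_approx => //.
    by apply: cont_onB; apply: cq; lra.
  move=> t ht; have := aq x1 t ^~ ht; have := aq x2 t ^~ ht.
  rewrite !ler_norml /w => A1 A2.
  have {A1} := A1 ltac:(lra); have {A2} := A2 ltac:(lra); lra.
rewrite /circulation; move: I1 I2; rewrite -/w -/k !ler_norml expr2; lra.
Qed.

(* Quadrisection preserves the lower bound [eta * (width + height)^2], which
   contradicts differentiability at the point common to all the rectangles. *)
Lemma goursat x1 x2 y1 y2 : x1 <= x2 -> y1 <= y2 ->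
  closed_on p q x1 x2 y1 y2 -> circulation p q x1 x2 y1 y2 = 0.
Proof.
move=> xx yy cl; apply/eqP/negP => /negP J0.
pose w := x2 - x1; pose k := y2 - y1.
have w0 : 0 <= w by rewrite /w; lra.
have k0 : 0 <= k by rewrite /k; lra.
(* A rectangle reduced to a point is set apart, since [eta] divides by [(w + k) ^+ 2]. *)
have [wk|wk] := ltP 0 (w + k); last first.
  case/eqP: J0; have -> : x2 = x1 by rewrite /w /k in w0 k0 wk; lra.
  have -> : y2 = y1 by rewrite /w /k in w0 k0 wk; lra.
  rewrite /circulation !integ0 ?addr0 // => t; first by rewrite subrr.
  by rewrite subrr.
pose eta := `|circulation p q x1 x2 y1 y2| / (w + k) ^+ 2.
have eta0 : 0 < eta by rewrite divr_gt0 ?normr_gt0 // exprn_gt0.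
pose s n : R := 2^-1 ^+ n.
have s0 n : 0 < s n by rewrite exprn_gt0 // invr_gt0.
have sS n : s n = s n.+1 + s n.+1 by rewrite /s exprS; lra.
pose inside n (c : R * R) :=
  [/\ x1 <= c.1, c.1 + s n * w <= x2, y1 <= c.2 & c.2 + s n * k <= y2].
pose bad n (c : R * R) := inside n c /\ eta * (s n * (w + k)) ^+ 2 <=
  `|circulation p q c.1 (c.1 + s n * w) c.2 (c.2 + s n * k)|.
have step n c : bad n c -> exists c', bad n.+1 c' /\
   [/\ c.1 <= c'.1, c'.1 + s n.+1 * w <= c.1 + s n * w,
    c.2 <= c'.2 & c'.2 + s n.+1 * k <= c.2 + s n * k].
  case: c => x y [[/= ix ix' iy iy'] big].
  have sw : s n * w = s n.+1 * w + s n.+1 * w by rewrite sS; ring.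
  have sk : s n * k = s n.+1 * k + s n.+1 * k by rewrite sS; ring.
  set u := s n.+1 * w in sw *; set v := s n.+1 * k in sk *.
  have u0 : 0 <= u by rewrite mulr_ge0 // ltW.
  have v0 : 0 <= v by rewrite mulr_ge0 // ltW.
  apply: contrapT => no.
  have small x' y' : (x' = x \/ x' = x + u) -> (y' = y \/ y' = y + v) ->
      `|circulation p q x' (x' + u) y' (y' + v)| < eta * (u + v) ^+ 2.
    move=> hx hy; rewrite ltNge; apply/negP => bg; apply: no.
    exists (x', y'); split; last by rewrite /= sw sk; split; lra.
    split; last by rewrite /= mulrDr.
    by rewrite /inside /= -/u -/v; split; lra.
  have cl' : closed_on p q x (x + s n * w) y (y + s n * k).
    by apply: closed_onS cl _ _ _ _.
  move: big; rewrite leNgt => /negP; apply.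
  rewrite (@circulation_splitx _ _ _ _ (x + u)) //; [|lra..].
  rewrite (@circulation_splity _ _ _ _ (y + v)) //; [|try lra..]; last first.
    by apply: closed_onS cl' _ _ _ _; lra.
  rewrite (@circulation_splity (x + u) _ _ _ (y + v)) //; [|try lra..]; last first.
    by apply: closed_onS cl' _ _ _ _; lra.
  have -> : x + s n * w = x + u + u by lra.
  have -> : y + s n * k = y + v + v by lra.
  (* Four strict bounds [eta * (u + v) ^+ 2] add up to [eta * (2 * (u + v)) ^+ 2], the bound that
     the parent rectangle violates. *)
  have -> : s n * (w + k) = (u + v) + (u + v) by rewrite mulrDr; lra.
  have := small x y ltac:(by left) ltac:(by left).
  have := small (x + u) y ltac:(by right) ltac:(by left).
  have := small x (y + v) ltac:(by left) ltac:(by right).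
  have := small (x + u) (y + v) ltac:(by right) ltac:(by right).
  move: (circulation p q x (x + u) y (y + v)) => A.
  move: (circulation p q x (x + u) (y + v) (y + v + v)) => B.
  move: (circulation p q (x + u) (x + u + u) y (y + v)) => C.
  move: (circulation p q (x + u) (x + u + u) (y + v) (y + v + v)) => D.
  by rewrite !ltr_norml !expr2; nra.
have bad0 : bad 0%N (x1, y1).
  rewrite /bad /inside /= /s expr0 !mul1r /w /k.
  have -> : x1 + (x2 - x1) = x2 by ring.
  have -> : y1 + (y2 - y1) = y2 by ring.
  split; first by split.
  rewrite /eta mulfVK //; apply: lt0r_neq0; rewrite exprn_gt0 //.
(* With the existence made unconditional, the sequence can be defined by choice before its terms are
   known to be bad. *)
have stepT n c : exists c', bad n c -> bad n.+1 c' /\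
   [/\ c.1 <= c'.1, c'.1 + s n.+1 * w <= c.1 + s n * w,
    c.2 <= c'.2 & c'.2 + s n.+1 * k <= c.2 + s n * k].
  have [/step[c' h]|nb] := pselect (bad n c); first by exists c'.
  by exists c.
pose nxt n c := projT1 (cid (stepT n c)).
pose C := fix C n := if n is m.+1 then nxt m (C m) else (x1, y1).
have badC n : bad n (C n).
  elim: n => [//|n IH] /=.
  by rewrite /nxt; case: cid => c' /= /(_ IH)[].
have stepC n : [/\ (C n).1 <= (C n.+1).1,
    (C n.+1).1 + s n.+1 * w <= (C n).1 + s n * w,
    (C n).2 <= (C n.+1).2 & (C n.+1).2 + s n.+1 * k <= (C n).2 + s n * k].
  by rewrite /= /nxt; case: cid => c' /= /(_ (badC n))[].
(* Nested intervals: the supremum of the left endpoints lies in all of them. *)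
have lim_pt (u : nat -> R) (l : R) : 0 <= l ->
    (forall n, u n <= u n.+1 /\ u n.+1 + s n.+1 * l <= u n + s n * l) ->
    exists X, forall n, u n <= X <= u n + s n * l.
  move=> l0 hu.
  have up m n : (m <= n)%N -> u m <= u n.
    move=> /subnK <-; elim: (n - m)%N => [//|i IH].
    by apply: le_trans IH _; have [] := hu (i + m)%N.
  have dn m n : (m <= n)%N -> u n + s n * l <= u m + s m * l.
    move=> /subnK <-; elim: (n - m)%N => [//|i IH].
    by apply: le_trans IH; have [] := hu (i + m)%N.
  have ub n m : u m <= u n + s n * l.
    have sl j : 0 <= s j * l by rewrite mulr_ge0 // ltW.
    have [/up h|/ltnW/dn h] := leqP m n; first by have := sl n; lra.
    by have := sl m; lra.
  exists (sup (range u)) => n; apply/andP; split.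
    apply: ub_le_sup; last by exists n.
    by exists (u 0%N + s 0%N * l) => _ [m _ <-].
  by apply: ge_sup; [exists (u 0%N), 0%N|move=> _ [m _ <-]].
have [X hX] := lim_pt (fun n => (C n).1) w w0
  ltac:(by move=> n; have [] := stepC n).
have [Y hY] := lim_pt (fun n => (C n).2) k k0
  ltac:(by move=> n; have [] := stepC n).
have hX0 := hX 0%N; have hY0 := hY 0%N.
rewrite /= /s expr0 !mul1r in hX0 hY0.
have [||a [b [c [dp dq]]]] := cl X Y; [rewrite /w in hX0; lra| |].
  by rewrite /k in hY0; lra.
have e0 : 0 < eta / 2 by lra.
have [d d0 hd] := circulation_local e0 dp dq.
have [n hn] : exists n, s n * (w + k) < d.
  have : s n @[n --> \oo] --> (0 : R).
    by apply: cvg_expr; rewrite ger0_norm ?invr_ge0 // invf_lt1 // ltr1n.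
  move/cvgrPdist_lt => /(_ (d / (w + k))); case; first by rewrite divr_gt0.
  move=> N _ /(_ N (leqnn N)); rewrite sub0r normrN gtr0_norm //.
  by rewrite ltr_pdivlMr // => h; exists N.
have [[i1 i2 i3 i4] big] := badC n.
have swn : 0 <= s n * w by rewrite mulr_ge0 // ltW.
have skn : 0 <= s n * k by rewrite mulr_ge0 // ltW.
rewrite mulrDr in hn big.
have := hd _ _ _ _ (hX n) (hY n); rewrite ![(C n).1 + _ - _]addrAC subrr add0r.
rewrite ![(C n).2 + _ - _]addrAC subrr add0r.
move=> /(_ ltac:(lra) ltac:(lra)).
have cl' : closed_on p q (C n).1 ((C n).1 + s n * w) (C n).2 ((C n).2 + s n * k).
  by apply: closed_onS cl _ _ _ _.
move=> /(_ cl') /(le_trans big).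
have : 0 < s n * w + s n * k by rewrite -mulrDr mulr_gt0.
move: (s n * w + s n * k) => z z0; rewrite expr2.
have := mulr_gt0 eta0 (mulr_gt0 z0 z0); lra.
Qed.

End fixed_form.
End Goursat.

(** * Complex derivatives *)

Section ComplexDerivative.
Context {R : realType}.
Local Notation C := R[i].
Implicit Types (z w h d : C) (f g : C -> C) (x y e r : R).

(** The norm of [R[i]] takes values in [R[i]] itself, which is only partially ordered; a real-valued
    modulus brings the estimates within reach of [lra] and [nra]. *)
Definition cabs z : R := complex.Re `|z|.

Lemma normc_cabs z : `|z| = (cabs z)%:C%C.
Proof. by rewrite /cabs normc_def. Qed.

Lemma cabsE z : cabs z = Num.sqrt (complex.Re z ^+ 2 + complex.Im z ^+ 2).
Proof. by rewrite /cabs normc_def. Qed.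

Lemma cabs_ge0 z : 0 <= cabs z.
Proof. by rewrite cabsE sqrtr_ge0. Qed.

Lemma cabs_sqr z : cabs z ^+ 2 = complex.Re z ^+ 2 + complex.Im z ^+ 2.
Proof. by rewrite cabsE sqr_sqrtr // addr_ge0 // sqr_ge0. Qed.

Lemma cabsM z w : cabs (z * w) = cabs z * cabs w.
Proof.
by apply: (@complexI R); rewrite -normc_cabs normrM !normc_cabs rmorphM.
Qed.

Lemma cabsV z : cabs z^-1 = (cabs z)^-1.
Proof.
by apply: (@complexI R); rewrite -normc_cabs normfV !normc_cabs fmorphV.
Qed.

Lemma cabsD z w : cabs (z + w) <= cabs z + cabs w.
Proof.
by rewrite -lecR rmorphD /= -!normc_cabs ler_normD.
Qed.

Lemma cabsN z : cabs (- z) = cabs z.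
Proof. by rewrite /cabs normrN. Qed.

Lemma cabsB z w : cabs (z - w) <= cabs z + cabs w.
Proof. by rewrite -(cabsN w) cabsD. Qed.

Lemma cabsBC z w : cabs (z - w) = cabs (w - z).
Proof. by rewrite -cabsN opprB. Qed.

Lemma ler_cabs_dist z w : `|cabs z - cabs w| <= cabs (z - w).
Proof.
have h1 := cabsD (z - w) w; have h2 := cabsD (w - z) z.
by rewrite !subrK (cabsBC w) in h1 h2; rewrite ler_norml; lra.
Qed.

Lemma cabs0 : cabs 0 = 0.
Proof. by rewrite /cabs normr0. Qed.

Lemma cabs1 : cabs 1 = 1.
Proof. by rewrite /cabs normr1. Qed.

Lemma cabs_eq0 z : (cabs z == 0) = (z == 0).
Proof.
by rewrite -[RHS]normr_eq0 normc_cabs -(inj_eq (@complexI R)).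
Qed.

Lemma cabs_gt0 z : (0 < cabs z) = (z != 0).
Proof. by rewrite lt0r cabs_ge0 andbT cabs_eq0. Qed.

Lemma normRe_le z : `|complex.Re z| <= cabs z.
Proof.
rewrite -ler_sqr ?nnegrE ?cabs_ge0 // cabs_sqr real_normK ?num_real //.
by rewrite lerDl sqr_ge0.
Qed.

Lemma normIm_le z : `|complex.Im z| <= cabs z.
Proof.
rewrite -ler_sqr ?nnegrE ?cabs_ge0 // cabs_sqr real_normK ?num_real //.
by rewrite lerDr sqr_ge0.
Qed.

Lemma cabs_le z : cabs z <= `|complex.Re z| + `|complex.Im z|.
Proof.
rewrite -ler_sqr ?nnegrE ?cabs_ge0 ?addr_ge0 // cabs_sqr sqrrD.
rewrite !real_normK ?num_real // -addrA [_ *+ 2 + _]addrC addrA lerDl.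
by rewrite mulrn_wge0 // mulr_ge0.
Qed.

Lemma cabs_real x : cabs (x%:C)%C = `|x|.
Proof. by rewrite cabsE /= expr0n /= addr0 sqrtr_sqr. Qed.

Lemma ReB z w : complex.Re (z - w) = complex.Re z - complex.Re w.
Proof. by case: z; case: w. Qed.

Lemma ImB z w : complex.Im (z - w) = complex.Im z - complex.Im w.
Proof. by case: z; case: w. Qed.

Lemma ReD z w : complex.Re (z + w) = complex.Re z + complex.Re w.
Proof. by case: z; case: w. Qed.

Lemma ReM z w : complex.Re (z * w) =
  complex.Re z * complex.Re w - complex.Im z * complex.Im w.
Proof. by case: z; case: w. Qed.

Lemma ImM z w : complex.Im (z * w) =
  complex.Re z * complex.Im w + complex.Im z * complex.Re w.
Proof. by case: z => a b; case: w => c d /=. Qed.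

Lemma ReZ x z : complex.Re ((x%:C)%C * z) = x * complex.Re z.
Proof. by rewrite ReM mul0r subr0. Qed.

Lemma cabs_ball z r w : ball z (r%:C)%C w <-> cabs (z - w) < r.
Proof.
by rewrite -(ltcR (cabs _)) -normc_cabs -ball_normE.
Qed.

Lemma nbhs_cabsP z (A : set C) : nbhs z A <->
  exists2 r, 0 < r & forall w, cabs (z - w) < r -> A w.
Proof.
split=> [/nbhs_ballP[e /= e0 he]|[r r0 hr]].
  have eE : e = ((complex.Re e)%:C)%C.
    by rewrite RRe_real // realE ltW.
  exists (complex.Re e); first by rewrite -ltcR -eE.
  by move=> w /cabs_ball; rewrite -eE; exact: he.
apply/nbhs_ballP; exists (r%:C)%C; first by rewrite /= ltcR.
by move=> w /cabs_ball; exact: hr.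
Qed.

(** Being free of quotients, this form needs no exception at [h = 0], and its remainders can be
    bounded uniformly and integrated. *)
Definition cdiff f z d := forall e, 0 < e -> exists2 r, 0 < r &
  forall h, cabs h < r -> cabs (f (z + h) - f z - d * h) <= e * cabs h.

Lemma derivable_cdiff f z : derivable f z 1 -> exists d, cdiff f z d.
Proof.
move=> df; exists ('D_1 f z) => e e0.
have /cvgrPdist_le/(_ (e%:C)%C) := df.
rewrite ltcR => /(_ e0) /nbhs_cabsP[r r0 hr]; exists r => // h hr'.
have [->|h0] := eqVneq h 0; first by rewrite addr0 subrr mulr0 subrr cabs0 mulr0.
have H : `|'D_1 f z - h^-1 * (f (z + h) - f z)| <= (e%:C)%C.
  rewrite [z + h]addrC -{2}[h]mulr1.
  by apply: (hr h _ h0); rewrite sub0r cabsN.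
rewrite normc_cabs lecR in H.
pose q := 'D_1 f z - h^-1 * (f (z + h) - f z).
have -> : f (z + h) - f z - 'D_1 f z * h = - (q * h).
  rewrite /q; set u := f (z + h) - f z; rewrite mulrBl opprB mulrAC mulVf //.
  by rewrite mul1r.
by rewrite cabsN cabsM ler_wpM2r // cabs_ge0.
Qed.

Lemma cdiff_lip f z d : cdiff f z d -> exists2 r, 0 < r &
  forall h, cabs h < r -> cabs (f (z + h) - f z) <= (cabs d + 1) * cabs h.
Proof.
move=> /(_ 1 ltr01)[r r0 hr]; exists r => // h /hr H.
have -> : f (z + h) - f z = (f (z + h) - f z - d * h) + d * h by rewrite subrK.
by apply: le_trans (cabsD _ _) _; rewrite cabsM; lra.
Qed.

Lemma cdiff_cst (a : C) z : cdiff (fun=> a) z 0.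
Proof.
move=> e e0; exists 1 => // h _.
by rewrite subrr mul0r subrr cabs0 mulr_ge0 ?cabs_ge0 // ltW.
Qed.

Lemma cdiff_id z : cdiff id z 1.
Proof.
move=> e e0; exists 1 => // h _.
have -> : z + h - z - 1 * h = 0 by ring.
by rewrite cabs0 mulr_ge0 ?cabs_ge0 // ltW.
Qed.

Lemma cdiffD f g z d d' : cdiff f z d -> cdiff g z d' ->
  cdiff (fun w => f w + g w) z (d + d').
Proof.
move=> df dg e e0; have e2 : 0 < e / 2 by lra.
have [r1 r10 h1] := df _ e2; have [r2 r20 h2] := dg _ e2.
exists (Num.min r1 r2) => [|h]; first by rewrite lt_min r10.
rewrite lt_min => /andP[/h1 {}h1 /h2 {}h2].
have -> : f (z + h) + g (z + h) - (f z + g z) - (d + d') * h =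
  (f (z + h) - f z - d * h) + (g (z + h) - g z - d' * h) by ring.
by apply: le_trans (cabsD _ _) _; lra.
Qed.

Lemma cdiff_comp f g z d d' : cdiff f z d -> cdiff g (f z) d' ->
  cdiff (g \o f) z (d' * d).
Proof.
move=> df dg e e0; have [r1 r10 h1] := cdiff_lip df.
pose M := cabs d + 1; pose M' := cabs d' + 1.
have M0 : 0 < M by rewrite /M; have := cabs_ge0 d; lra.
have M0' : 0 < M' by rewrite /M'; have := cabs_ge0 d'; lra.
have eM : 0 < e / 2 / M by do !apply: divr_gt0.
have eM' : 0 < e / 2 / M' by do !apply: divr_gt0.
have [r2 r20 h2] := dg _ eM; have [r3 r30 h3] := df _ eM'.
exists (Num.min r1 (Num.min (r2 / M) r3)).
  by rewrite !lt_min r10 r30 divr_gt0.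
move=> h; rewrite !lt_min => /and3P[k1 k2 k3].
have := h1 _ k1; rewrite -/M => {}h1.
have /h2 : cabs (f (z + h) - f z) < r2.
  by apply: le_lt_trans h1 _; rewrite mulrC -ltr_pdivlMr.
rewrite subrKC => {}h2; have {}h3 := h3 _ k3; rewrite /comp.
have -> : g (f (z + h)) - g (f z) - d' * d * h =
  (g (f (z + h)) - g (f z) - d' * (f (z + h) - f z)) +
  d' * (f (z + h) - f z - d * h) by ring.
apply: le_trans (cabsD _ _) _; rewrite cabsM.
have A : e / 2 / M * cabs (f (z + h) - f z) <= e / 2 * cabs h.
  rewrite -[X in _ <= X * _](divfK (lt0r_neq0 M0)) -[X in _ <= X]mulrA.
  by rewrite ler_wpM2l // ltW.
have B : cabs d' * cabs (f (z + h) - f z - d * h) <= e / 2 * cabs h.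
  have -> : e / 2 * cabs h = M' * (e / 2 / M' * cabs h).
    by field; rewrite lt0r_neq0.
  by apply: ler_pM => //; rewrite ?cabs_ge0 // /M'; lra.
lra.
Qed.

Lemma cdiff_sqr z : cdiff (fun w => w * w) z (2 * z).
Proof.
move=> e e0; exists e => // h he.
have -> : (z + h) * (z + h) - z * z - 2 * z * h = h * h by ring.
by rewrite cabsM ler_wpM2r ?cabs_ge0 // ltW.
Qed.

Lemma cdiffZ (a : C) f z d : cdiff f z d -> cdiff (fun w => a * f w) z (a * d).
Proof.
move=> df; apply: (@cdiff_comp f (fun w => a * w)) => // e e0.
exists 1 => // h _.
have -> : a * (f z + h) - a * f z - a * h = 0 by ring.
by rewrite cabs0 mulr_ge0 ?cabs_ge0 // ltW.
Qed.

Lemma cdiffB f g z d d' : cdiff f z d -> cdiff g z d' ->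
  cdiff (fun w => f w - g w) z (d - d').
Proof.
move=> df dg; have := cdiffD df (cdiffZ (-1) dg); rewrite mulN1r.
by under eq_fun do rewrite mulN1r.
Qed.

(* Polarization reduces products to squares. *)
Lemma cdiffM f g z d d' : cdiff f z d -> cdiff g z d' ->
  cdiff (fun w => f w * g w) z (d * g z + f z * d').
Proof.
move=> df dg.
have S := cdiff_comp (cdiffD df dg) (cdiff_sqr _).
have D := cdiff_comp (cdiffB df dg) (cdiff_sqr _).
have := cdiffZ (4^-1) (cdiffB S D); rewrite /comp /=.
have -> : (fun w => 4^-1 * ((f w + g w) * (f w + g w) -
   (f w - g w) * (f w - g w))) = (fun w => f w * g w) :> (C -> C).
  by apply/funext => w; field.
by congr cdiff; field.
Qed.

Lemma is_derive_approx (f : R -> R) x (df : R) : is_derive x 1 f df ->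
  forall e, 0 < e -> exists2 r, 0 < r &
  forall h : R, `|h| < r -> `|f (x + h) - f x - df * h| <= e * `|h|.
Proof.
move=> [dfx <-] e e0.
have /cvgrPdist_le/(_ _ e0) := dfx.
move=> /nbhs_ballP[r /= r0 hr]; exists r => // h hr'.
have [->|h0] := eqVneq h 0; first by rewrite addr0 subrr mulr0 subrr normr0 mulr0.
have H : `|'D_1 f x - h^-1 * (f (x + h) - f x)| <= e.
  rewrite [x + h]addrC -{2}[h]mulr1.
  by apply: (hr h _ h0); rewrite /ball /= sub0r normrN.
pose q := 'D_1 f x - h^-1 * (f (x + h) - f x).
have -> : f (x + h) - f x - 'D_1 f x * h = - (q * h).
  rewrite /q; set u := f (x + h) - f x; rewrite mulrBl opprB mulrAC mulVf //.
  by rewrite mul1r.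
by rewrite normrN normrM ler_wpM2r.
Qed.

(** * The complex exponential and the Cauchy-Riemann equations *)

Definition cexp z : C :=
  ((expR (complex.Re z) * cos (complex.Im z)) +i*
   (expR (complex.Re z) * sin (complex.Im z)))%C.

Lemma cexpD z w : cexp (z + w) = cexp z * cexp w.
Proof.
case: z => a b; case: w => c d; rewrite /cexp /= expRD cosD sinD.
by apply/eqP; rewrite eq_complex /=; apply/andP; split; apply/eqP; ring.
Qed.

Lemma cexp0 : cexp 0 = 1.
Proof. by rewrite /cexp /= expR0 cos0 sin0 mulr1 mulr0. Qed.

Lemma cabs_cexp z : cabs (cexp z) = expR (complex.Re z).
Proof.
by rewrite cabsE /cexp /= !exprMn -mulrDr cos2Dsin2 mulr1 sqrtr_sqr ger0_norm //.
Qed.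

Lemma cdiff_cexp z : cdiff cexp z (cexp z).
Proof.
(* The point [0] is enough: the addition formula extracts the factor [cexp z] elsewhere. *)
have at0 : cdiff cexp 0 1.
  move=> e e0.
  (* The real and imaginary errors below cost 3 and 5 times [e' * N], hence the 8. *)
  have [e' [e'0 e'1 e'e]] : exists e', [/\ 0 < e', e' <= 1 & e' <= e / 8].
    exists (Num.min (e / 8) 1); split; rewrite ?ge_min ?lexx ?orbT //.
    by rewrite lt_min; apply/andP; split; lra.
  have [r1 r10 h1] := is_derive_approx (is_derive_expR (0 : R)) e'0.
  have [r2 r20 h2] := is_derive_approx (is_derive_sin (0 : R)) e'0.
  have [r3 r30 h3] := is_derive_approx (is_derive_cos (0 : R)) e'0.
  exists (Num.min (Num.min r1 r2) (Num.min r3 e')).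
    by rewrite !lt_min r10 r20 r30.
  move=> h; rewrite !lt_min => /andP[/andP[k1 k2] /andP[k3 k4]].
  have hx := normRe_le h; have hy := normIm_le h.
  have := h1 _ (le_lt_trans hx k1); have := h2 _ (le_lt_trans hy k2).
  have := h3 _ (le_lt_trans hy k3).
  rewrite !add0r expR0 cos0 sin0 oppr0 addr0 mul0r !mul1r !subr0 cexp0 => A3 A2 A1.
  apply: le_trans (cabs_le _) _; rewrite !ReB !ImB /cexp /= subr0.
  set X := complex.Re h in hx A1 *; set Y := complex.Im h in hy A2 A3 *.
  set N := cabs h in hx hy k4 *; have N0 : 0 <= N := cabs_ge0 h.
  set a := expR X in A1 *; set c := cos Y in A3 *; set s := sin Y in A2 *.
  have c1 : `|c| <= 1 := cos_max Y.
  have B1 : `|a - 1 - X| <= e' * N by apply: le_trans A1 _; rewrite ler_pM2l.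
  have B2 : `|s - Y| <= e' * N by apply: le_trans A2 _; rewrite ler_pM2l.
  have B3 : `|c - 1| <= e' * N by apply: le_trans A3 _; rewrite ler_pM2l.
  have eN : e' * N <= N by rewrite ler_piMl.
  have B4 : `|a - 1| <= 2 * e'.
    have -> : a - 1 = (a - 1 - X) + X by ring.
    by apply: le_trans (ler_normD _ _) _; lra.
  have B5 : `|s| <= 2 * N.
    have -> : s = (s - Y) + Y by ring.
    by apply: le_trans (ler_normD _ _) _; lra.
  have P1 : `|(a - 1 - X) * c| <= e' * N.
    by rewrite normrM -[X in _ <= X]mulr1 ler_pM.
  have P2 : `|(1 + X) * (c - 1)| <= 2 * (e' * N).
    rewrite normrM ler_pM //; apply: le_trans (ler_normD _ _) _.
    by rewrite normr1; lra.
  have P3 : `|(a - 1) * s| <= (2 * e') * (2 * N) by rewrite normrM ler_pM.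
  have E1 : `|a * c - 1 - X| <= 3 * (e' * N).
    have -> : a * c - 1 - X = (a - 1 - X) * c + (1 + X) * (c - 1) by ring.
    by apply: le_trans (ler_normD _ _) _; lra.
  have E2 : `|a * s - Y| <= 5 * (e' * N).
    have -> : a * s - Y = (a - 1) * s + (s - Y) by ring.
    by apply: le_trans (ler_normD _ _) _; lra.
  have E3 : 8 * (e' * N) <= e * N.
    by rewrite mulrA ler_wpM2r //; lra.
  lra.
move=> e e0; have M0 := expR_gt0 (complex.Re z).
have [|r r0 hr] := at0 (e / expR (complex.Re z)); first exact: divr_gt0.
exists r => // h /hr; rewrite add0r cexp0 mul1r cexpD => H.
have -> : cexp z * cexp h - cexp z - cexp z * h = cexp z * (cexp h - 1 - h).
  by ring.
rewrite cabsM cabs_cexp; have := H; rewrite -(ler_pM2l M0) => /le_trans; apply.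
by rewrite mulrA [expR _ * _]mulrC divfK // lt0r_neq0.
Qed.

(** The two functions are the coefficients of [Re (f dz)]. By the Cauchy-Riemann equations [- Im d]
    is both the [y]-slope of the first and the [x]-slope of the second, which is the closedness that
    Goursat's theorem asks for. *)
Lemma cdiff_has_diff2 f x y d : cdiff f (x +i* y)%C d ->
  has_diff2 (fun x y => complex.Re (f (x +i* y)%C)) x y
    (complex.Re d) (- complex.Im d) /\
  has_diff2 (fun x y => - complex.Im (f (x +i* y)%C)) x y
    (- complex.Im d) (- complex.Re d).
Proof.
move=> df.
have key e : 0 < e -> exists2 r, 0 < r & forall h k : R, `|h| < r -> `|k| < r ->
    cabs (f ((x + h) +i* (y + k))%C - f (x +i* y)%C - d * (h +i* k)%C)
    <= e * (`|h| + `|k|).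
  move=> e0; have [r r0 hr] := df _ e0; exists (r / 2) => [|h k hh hk].
    by lra.
  have hk' : cabs (h +i* k)%C <= `|h| + `|k| := cabs_le _.
  have hr' : cabs (h +i* k)%C < r by apply: le_lt_trans hk' _; lra.
  have H : cabs (f ((x + h) +i* (y + k))%C - f (x +i* y)%C - d * (h +i* k)%C)
    <= e * cabs (h +i* k)%C := hr _ hr'.
  by apply: le_trans H _; rewrite ler_pM2l.
split=> e /key[r r0 hr]; exists r => // h k hh hk; have {hr} := hr h k hh hk.
  apply: le_trans; apply: le_trans (normRe_le _); rewrite !ReB ReM /=.
  by rewrite [X in X <= _](_ : _ = `|complex.Re (f ((x + h) +i* (y + k))%C)
    - complex.Re (f (x +i* y)%C)
    - (complex.Re d * h - complex.Im d * k)|) //; congr `|_|; ring.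
apply: le_trans; apply: le_trans (normIm_le _); rewrite !ImB ImM /=.
by rewrite -normrN [X in X <= _](_ : _ = `|complex.Im (f ((x + h) +i* (y + k))%C)
    - complex.Im (f (x +i* y)%C)
    - (complex.Re d * k + complex.Im d * h)|) //; congr `|_|; ring.
Qed.

End ComplexDerivative.

(** * Unique continuation *)

Section Continuation.
Context {R : realType}.
Local Notation C := R[i].
Implicit Types (f : C -> C) (a b r : R).

Lemma cont_on_bounded (u : R -> R) a b : cont_on u a b ->
  exists2 M, 0 < M & forall t, a <= t <= b -> `|u t| <= M.
Proof.
move=> cu; have [ab|ba] := leP a b; last first.
  by exists 1 => // t; lra.
have [|c _ hc] := @EVT_max R (fun t => `|u t|) a b ab.
  apply: cont_on_within => t /cu ct.
  by apply: (@continuous_comp _ _ _ u) => //; exact: norm_continuous.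
exists (`|u c| + 1) => [|t ht]; first by rewrite ltr_wpDl.
by apply: le_trans (hc t _) _; rewrite ?in_itv //= lerDl.
Qed.

Lemma cdiff_bounded_h f y a b :
  (forall x, a <= x <= b -> exists d, cdiff f (x +i* y)%C d) ->
  exists2 M, 0 < M & forall x, a <= x <= b -> cabs (f (x +i* y)%C) <= M.
Proof.
move=> df.
have cRe : cont_on (fun x => complex.Re (f (x +i* y)%C)) a b.
  by move=> x /df[d /cdiff_has_diff2[/has_diff2_cont[]]].
have cIm : cont_on (fun x => - complex.Im (f (x +i* y)%C)) a b.
  by move=> x /df[d /cdiff_has_diff2[_ /has_diff2_cont[]]].
have [M M0 hM] := cont_on_bounded cRe; have [M' M0' hM'] := cont_on_bounded cIm.
exists (M + M') => [|x hx]; first exact: addr_gt0.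
by apply: le_trans (cabs_le _) _; rewrite lerD ?hM // -normrN hM'.
Qed.

Lemma cdiff_bounded_v f x a b :
  (forall y, a <= y <= b -> exists d, cdiff f (x +i* y)%C d) ->
  exists2 M, 0 < M & forall y, a <= y <= b -> cabs (f (x +i* y)%C) <= M.
Proof.
move=> df.
have cRe : cont_on (fun y => complex.Re (f (x +i* y)%C)) a b.
  by move=> y /df[d /cdiff_has_diff2[/has_diff2_cont[]]].
have cIm : cont_on (fun y => - complex.Im (f (x +i* y)%C)) a b.
  by move=> y /df[d /cdiff_has_diff2[_ /has_diff2_cont[]]].
have [M M0 hM] := cont_on_bounded cRe; have [M' M0' hM'] := cont_on_bounded cIm.
exists (M + M') => [|y hy]; first exact: addr_gt0.
by apply: le_trans (cabs_le _) _; rewrite lerD ?hM // -normrN hM'.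
Qed.

Definition gauss (N : R) (z0 z : C) : C :=
  cexp ((N%:C)%C * ((z - z0) * (z - z0))).

Lemma cdiff_gauss N z0 z : exists d, cdiff (gauss N z0) z d.
Proof.
eexists; apply: (@cdiff_comp _ (fun z => (N%:C)%C * ((z - z0) * (z - z0))) cexp);
  last exact: cdiff_cexp.
apply: cdiffZ; apply: (@cdiff_comp _ (fun z => z - z0) (fun w => w * w));
  last exact: cdiff_sqr.
by apply: cdiffB; [exact: cdiff_id|exact: cdiff_cst].
Qed.

Lemma cabs_gauss N (x0 y0 x y : R) : cabs (gauss N (x0 +i* y0)%C (x +i* y)%C) =
  expR (N * ((x - x0) ^+ 2 - (y - y0) ^+ 2)).
Proof.
by rewrite cabs_cexp /= !mul0r subr0 !expr2.
Qed.

(** On the vertical line through [z0] the kernel is real and positive, so multiplying by it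
    preserves the sign of the imaginary part of [f]. *)
Lemma gauss_v N (x0 y0 y : R) : gauss N (x0 +i* y0)%C (x0 +i* y)%C =
  ((expR (- (N * (y - y0) ^+ 2)))%:C)%C.
Proof.
rewrite /gauss /cexp /= !subrr !(mul0r, mulr0, addr0, add0r, subr0, sub0r).
by rewrite sin0 cos0 mulr1 mulr0 mulrN expr2.
Qed.

(* The Gaussian kernel [exp (N (z - z0)^2)] concentrates at [z0] on the right
   edge, and is negligible on the horizontal edges because [a < b]. *)
Lemma rectangle_continuation f (x0 y0 a b : R) : 0 <= a -> a < b ->
  (forall x y, x0 - a <= x <= x0 -> y0 - b <= y <= y0 + b ->
    exists d, cdiff f (x +i* y)%C d) ->
  (forall y, y0 - b <= y <= y0 + b -> f ((x0 - a) +i* y)%C = 0) ->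
  f (x0 +i* y0)%C = 0.
Proof.
move=> a0 ab df0 fl0; apply/eqP/negP => /negP fz0.
(* Normalized to the value [-i] at [z0], so that the coefficient of [dy], which is minus the
   imaginary part, equals 1 there. *)
pose lam : C := (0 -i* 1)%C / f (x0 +i* y0)%C.
pose f1 z := lam * f z.
have {df0} df x y : x0 - a <= x <= x0 -> y0 - b <= y <= y0 + b ->
    exists d, cdiff f1 (x +i* y)%C d.
  by move=> hx hy; have [d hd] := df0 x y hx hy; exists (lam * d); exact: cdiffZ.
have {}fl0 y : y0 - b <= y <= y0 + b -> f1 ((x0 - a) +i* y)%C = 0.
  by move=> /fl0 h; rewrite /f1 h mulr0.
have f1z : f1 (x0 +i* y0)%C = (0 -i* 1)%C by rewrite /f1 /lam divfK.
clearbody f1; clear lam fz0 f.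
have b0 : 0 < b by lra.
have xx : x0 - a <= x0 by lra.
have yy : y0 - b <= y0 + b by lra.
have [M [M0 Mt Mb Mr]] : exists M, [/\ 0 < M,
    forall x, x0 - a <= x <= x0 -> cabs (f1 (x +i* (y0 + b))%C) <= M,
    forall x, x0 - a <= x <= x0 -> cabs (f1 (x +i* (y0 - b))%C) <= M &
    forall y, y0 - b <= y <= y0 + b -> cabs (f1 (x0 +i* y)%C) <= M].
  have [|M1 M10 h1] := @cdiff_bounded_h f1 (y0 + b) (x0 - a) x0.
    by move=> x hx; apply: df => //; lra.
  have [|M2 M20 h2] := @cdiff_bounded_h f1 (y0 - b) (x0 - a) x0.
    by move=> x hx; apply: df => //; lra.
  have [|M3 M30 h3] := @cdiff_bounded_v f1 x0 (y0 - b) (y0 + b).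
    by move=> x hx; apply: df => //; lra.
  exists (M1 + M2 + M3); split=> [|t /h1|t /h2|t /h3] *; lra.
(* [del] is the half-length of a window around [z0] on the right edge. The bound
   [del ^+ 2 <= b ^+ 2 - a ^+ 2] makes the kernel on the horizontal edges at most its value at the
   ends of the window; [b - a] satisfies it because [0 <= a]. *)
have [del [del0 delb delab fdel]] : exists del, [/\ 0 < del, del <= b,
    del ^+ 2 <= b ^+ 2 - a ^+ 2 &
    forall y, `|y - y0| < del -> 1 / 2 <= - complex.Im (f1 (x0 +i* y)%C)].
  have [||d hd] := df x0 y0; [lra|lra|].
  have [_ /has_diff2_cont[_ /cvgrPdist_le]] := cdiff_has_diff2 hd.
  have h2 : 0 < 1 / 2 :> R by lra.
  move=> /(_ _ h2) /nbhs_ballP[r /= r0 hr].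
  exists (Num.min r (b - a)); split.
  - by rewrite lt_min r0; lra.
  - by rewrite ge_min; apply/orP; right; lra.
  - apply: (@le_trans _ _ ((b - a) ^+ 2)); last by rewrite !expr2; nra.
    rewrite ler_sqr ?nnegrE; last lra.
      by rewrite ge_min lexx orbT.
    by rewrite le_min ltW //=; lra.
  - move=> y; rewrite lt_min => /andP[hy _].
    have := hr y; rewrite /ball /= distrC => /(_ hy); rewrite f1z /= opprK.
    by rewrite ler_norml; lra.
(* Large enough for the final contradiction: there [expR (3 / 4 * (N * del ^+ 2)) * del] is at most
   [4 * M * (a + b)], while this [N] makes it at least [del + 6 * (M * (a + b))]. *)
pose N := 8 * M * (a + b) / del ^+ 3.
have Ndel : N * del ^+ 2 = 8 * (M * (a + b) / del).
  by rewrite /N; field; rewrite lt0r_neq0.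
have N0 : 0 < N.
  by rewrite divr_gt0 ?exprn_gt0 // mulr_gt0 ?mulr_gt0 //; lra.
clearbody N.
pose z0 : C := (x0 +i* y0)%C; pose g z := f1 z * gauss N z0 z.
pose p x y := complex.Re (g (x +i* y)%C).
pose q x y := - complex.Im (g (x +i* y)%C).
have cl : closed_on p q (x0 - a) x0 (y0 - b) (y0 + b).
  move=> x y hx hy; have [d hd] := df x y hx hy.
  have [d' hd'] := cdiff_gauss N z0 (x +i* y)%C.
  have /cdiff_has_diff2[h1 h2] := cdiffM hd hd'.
  by do 3 eexists; split; [exact: h1|exact: h2].
have := goursat xx yy cl; rewrite /circulation.
have [cp cq] := closed_on_cont cl.
pose eps := expR (- (N * del ^+ 2)).
have eps0 : 0 < eps := expR_gt0 _.
have sq_le (u v : R) : `|u| <= v -> u ^+ 2 <= v ^+ 2.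
  move=> uv; rewrite -[u ^+ 2]real_normK ?num_real // ler_sqr ?nnegrE //.
  exact: le_trans uv.
have hor x s : x0 - a <= x <= x0 -> s ^+ 2 = b ^+ 2 ->
    cabs (f1 (x +i* (y0 + s))%C) <= M -> `|p x (y0 + s)| <= M * eps.
  move=> hx hs hM; apply: le_trans (normRe_le _) _; rewrite cabsM cabs_gauss.
  apply: ler_pM; rewrite ?cabs_ge0 ?expR_ge0 // ler_expR.
  have -> : - (N * del ^+ 2) = N * (- del ^+ 2) by rewrite mulrN.
  rewrite [y0 + s]addrC addrK hs ler_pM2l // lerBlDr.
  have : (x - x0) ^+ 2 <= a ^+ 2 by apply: sq_le; rewrite ler_norml; lra.
  lra.
have H1 : - (2 * M * eps) * (x0 - (x0 - a)) <=
    integ (fun x => p x (y0 - b) - p x (y0 + b)) (x0 - a) x0.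
  apply: integ_ge => //; first by apply: cont_onB; apply: cp; lra.
  move=> x hx; have := hor x b hx erefl (Mt x hx).
  have := hor x (- b) hx (sqrrN b) (Mb x hx).
  by rewrite !ler_norml; lra.
pose psi y := q x0 y - q (x0 - a) y.
have psiE y : y0 - b <= y <= y0 + b -> psi y =
    - complex.Im (f1 (x0 +i* y)%C) * expR (- (N * (y - y0) ^+ 2)).
  move=> hy; rewrite /psi /q /g fl0 // mul0r oppr0 subr0 gauss_v ImM /=.
  by rewrite mulr0 add0r mulNr.
have cpsi : cont_on psi (y0 - b) (y0 + b) by apply: cont_onB; apply: cq; lra.
(* Inside the window the integrand is nonnegative; outside it the kernel is at most [eps]. *)
have outer y : y0 - b <= y <= y0 + b -> - (M * eps) <= psi y.
  move=> hy; rewrite psiE //; have [hd|hd] := ltP `|y - y0| del.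
    apply: (@le_trans _ _ 0); first by rewrite oppr_le0 mulr_ge0 // ltW.
    by rewrite mulr_ge0 ?expR_ge0 //; have := fdel _ hd; lra.
  have e1 : expR (- (N * (y - y0) ^+ 2)) <= eps.
    rewrite ler_expR lerN2 ler_pM2l // -[X in _ <= X]real_normK ?num_real //.
    by rewrite ler_sqr ?nnegrE // ltW.
  rewrite mulNr lerN2; apply: le_trans (ler_norm _) _.
  rewrite normrM [X in _ * X]ger0_norm ?expR_ge0 //.
  apply: ler_pM; rewrite ?expR_ge0 //; apply: le_trans (normIm_le _) _.
  exact: Mr.
(* A lower bound for the kernel on the inner half of the window; the gap between [del ^+ 2 / 4] and
   [del ^+ 2] makes it exceed [eps] by an exponential factor. *)
pose e1 := expR (- (N * (del / 2) ^+ 2)).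
have e10 : 0 < e1 := expR_gt0 _.
have inner y : y0 - del / 2 <= y <= y0 + del / 2 -> 1 / 2 * e1 <= psi y.
  move=> hy; have hy' : `|y - y0| <= del / 2 by rewrite ler_norml; lra.
  rewrite psiE; last by lra.
  apply: ler_pM; [lra|exact: ltW| |].
    by apply: fdel; apply: le_lt_trans hy' _; lra.
  by rewrite ler_expR lerN2 ler_pM2l //; exact: sq_le.
have -> : integ (fun y => q x0 y - q (x0 - a) y) (y0 - b) (y0 + b) =
    integ psi (y0 - b) (y0 - del / 2) + (integ psi (y0 - del / 2) (y0 + del / 2)
    + integ psi (y0 + del / 2) (y0 + b)).
  rewrite -integ_split; [|lra|lra|]; last by apply: cont_onS cpsi _ _; lra.
  by rewrite -integ_split //; lra.
have I1 : - (M * eps) * (y0 - del / 2 - (y0 - b)) <=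
    integ psi (y0 - b) (y0 - del / 2).
  apply: integ_ge; [lra| |by move=> y hy; apply: outer; lra].
  by apply: cont_onS cpsi _ _; lra.
have I3 : - (M * eps) * (y0 + b - (y0 + del / 2)) <=
    integ psi (y0 + del / 2) (y0 + b).
  apply: integ_ge; [lra| |by move=> y hy; apply: outer; lra].
  by apply: cont_onS cpsi _ _; lra.
have I2 : 1 / 2 * e1 * (y0 + del / 2 - (y0 - del / 2)) <=
    integ psi (y0 - del / 2) (y0 + del / 2).
  apply: integ_ge; [lra| |exact: inner].
  by apply: cont_onS cpsi _ _; lra.
move=> J0.
(* The horizontal edges cost at most [2 * M * a * eps] and the outer parts of the right edge at most
   [2 * M * b * eps]. *)
have {H1 I1 I2 I3 J0} : 1 / 2 * e1 * del <= 2 * M * (a + b) * eps.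
  have Md : 0 <= M * eps * del by rewrite !mulr_ge0 // ltW.
  move: H1 I1 I2 I3 J0; move: (integ _ _ _) (integ _ _ _) (integ _ _ _).
  by move: (integ _ _ _) => A1 A2 A3 A4; nra.
have -> : e1 = eps * expR (3 / 4 * (N * del ^+ 2)).
  by rewrite /e1 /eps -expRD; congr expR; field.
have := expR_ge1Dx (3 / 4 * (N * del ^+ 2)); rewrite Ndel.
set Q := expR _ => hQ h.
have h' : 1 / 2 * Q * del <= 2 * M * (a + b).
  rewrite -(ler_pM2r eps0); apply: le_trans h.
  by rewrite le_eqVlt; apply/orP; left; apply/eqP; ring.
have MM : 0 < M * (a + b) by rewrite mulr_gt0 //; lra.
have : (1 + 3 / 4 * (8 * (M * (a + b) / del))) * del <= Q * del.
  by rewrite ler_pM2r.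
have -> : (1 + 3 / 4 * (8 * (M * (a + b) / del))) * del =
  del + 6 * (M * (a + b)) by field; rewrite lt0r_neq0.
lra.
Qed.

Lemma polar (z : C) : z != 0 -> exists w, cexp w = z /\ expR (complex.Re w) = cabs z.
Proof.
move=> z0; have cz : 0 < cabs z by rewrite cabs_gt0.
pose x := complex.Re z / cabs z; pose y := complex.Im z / cabs z.
have xy : x ^+ 2 + y ^+ 2 = 1.
  rewrite /x /y !exprMn -mulrDl -cabs_sqr -exprMn mulfV ?expr1n //.
  exact: lt0r_neq0.
have x1 : -1 <= x <= 1.
  rewrite -ler_norml -(@ler_sqr _ `|x|) ?nnegrE // expr1n real_normK ?num_real //.
  by rewrite -xy lerDl sqr_ge0.
have [th [hc hs]] : exists th, cos th = x /\ sin th = y.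
  have sE : sin (acos x) = `|y|.
    by rewrite sin_acos // -xy addrC addKr sqrtr_sqr.
  have [y0|y0] := leP 0 y.
    by exists (acos x); rewrite acosK ?sE ?ger0_norm ?in_itv.
  exists (- acos x); rewrite cosN sinN acosK ?in_itv // sE ltr0_norm //.
  by rewrite opprK.
exists (ln (cabs z) +i* th)%C; rewrite /cexp /= lnK ?posrE // hc hs; split=> //.
apply/eqP; rewrite eq_complex /= /x /y ![cabs z * _]mulrC !divfK ?eqxx //;
exact: lt0r_neq0.
Qed.
End Continuation.

(** * Continuation on disks, for functions and for real parts *)

Section Identity.
Context {R : realType}.
Local Notation C := R[i].
Implicit Types (f H : C -> C) (z q h : C) (r rho : R).

(* In the logarithmic coordinate [z = q + exp w] the disk becomes a half-plane,
   which contains rectangles of arbitrarily large height. *)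
Lemma disk_continuation f q r rho : 0 < rho ->
  (forall z, cabs (z - q) < r -> exists d, cdiff f z d) ->
  (forall z, cabs (z - q) < rho -> f z = 0) ->
  forall z, cabs (z - q) < r -> f z = 0.
Proof.
move=> rho0 df f0 z zr; have [/f0 //|rz] := ltP (cabs (z - q)) rho.
have zq : z - q != 0 by rewrite -cabs_gt0; exact: lt_le_trans rz.
have [w [wz wr]] := polar zq.
pose x0 := complex.Re w; pose y0 := complex.Im w.
(* The exponential sends the left edge to the circle of radius [rho / 2] around [q], where [f]
   vanishes. *)
pose x1 := ln (rho / 2).
have x1E : expR x1 = rho / 2 by rewrite lnK // posrE; lra.
have x10 : x1 < x0 by rewrite -ltr_expR x1E wr; lra.
pose g v := f (q + cexp v).
have wE : w = (x0 +i* y0)%C by rewrite /x0 /y0; case: (w).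
have <- : g w = f z by rewrite /g wz subrKC.
(* The half-height is the width plus 1. The image may wind around [q] several times, which is
   harmless because [g] is a composition with the exponential and needs no inverse. *)
rewrite wE; apply: (@rectangle_continuation R g x0 y0 (x0 - x1) (x0 - x1 + 1)).
- lra.
- lra.
- move=> x y hx hy.
  have [|d hd] := df (q + cexp (x +i* y)%C).
    rewrite addrC addKr cabs_cexp /=; apply: le_lt_trans zr.
    by rewrite -wr ler_expR; lra.
  exists (d * (0 + cexp (x +i* y)%C)).
  apply: (@cdiff_comp _ (fun v => q + cexp v) f) => //.
  by apply: cdiffD; [exact: cdiff_cst|exact: cdiff_cexp].
- move=> y hy; apply: f0; rewrite addrC addKr cabs_cexp /=.
  by rewrite subKr x1E; lra.
Qed.

Lemma approx_is_derive (u : R -> R) (x d : R) :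
  (forall e, 0 < e -> exists2 s : R, 0 < s &
    forall h : R, `|h| < s -> `|u (x + h) - u x - d * h| <= e * `|h|) ->
  is_derive x 1 u d.
Proof.
move=> H.
have cv : h^-1 *: (u (h *: (1 : R) + x) - u x) @[h --> 0^'] --> d.
  apply/cvgrPdist_le => e /H[s s0 hs]; near=> h.
  have h0 : h != 0 by near: h; exact: nbhs_dnbhs_neq.
  have hh : `|h| < s.
    near: h; apply: (@nbhs_dnbhs _ (0 : R)); apply/nbhs_ballP; exists s => //= t.
    by rewrite /ball /= sub0r normrN.
  have := hs _ hh; rewrite -(ler_pM2r (_ : 0 < `|h|^-1)); last first.
    by rewrite invr_gt0 normr_gt0.
  rewrite mulfK ?normr_eq0 // -normfV -normrM distrC.
  have -> : h *: (1 : R) + x = x + h by rewrite addrC; congr (_ + _); exact: mulr1.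
  apply: le_trans; rewrite le_eqVlt; apply/orP; left; apply/eqP; congr `|_|.
  by rewrite mulrBl mulfK // [_ * h^-1]mulrC.
by split; [apply/cvg_ex; exists d|exact: cvg_lim].
Unshelve. all: by end_near. Qed.

(** Increments of [H] have real part 0, so [Re (d * h)] vanishes in every direction [h] of modulus
    1; the directions 1 and [i] kill both parts of [d]. *)
Lemma cdiff_Re0 H z d r : 0 < r -> cdiff H z d ->
  (forall h, cabs h < r -> complex.Re (H (z + h)) = 0) -> d = 0.
Proof.
move=> r0 dH H0.
have key h : cabs h = 1 -> complex.Re (d * h) = 0.
  move=> h1; apply/eqP; rewrite -normr_le0; apply/ler_addgt0Pr => e e0; rewrite add0r.
  have [s s0 hs] := dH _ e0; pose t := Num.min r s / 2.
  have rs : 0 < Num.min r s by rewrite lt_min r0.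
  have t0 : 0 < t by rewrite /t; lra.
  have [tr ts] : t < r /\ t < s.
    by apply/andP; rewrite -lt_min /t; lra.
  have ct : cabs ((t%:C)%C * h) = t by rewrite cabsM cabs_real h1 mulr1 gtr0_norm.
  have := hs ((t%:C)%C * h); rewrite ct => /(_ ts) /(le_trans (normRe_le _)).
  rewrite !ReB H0 ?ct // -[z in H z]addr0 H0 ?cabs0 //.
  rewrite subrr sub0r normrN mulrCA ReZ normrM gtr0_norm //.
  by rewrite mulrC ler_pM2r.
have := key 1 cabs1; have := key (0 +i* 1)%C.
rewrite mulr1 cabsE /= expr0n expr1n add0r sqrtr1 => /(_ erefl) /= hi hr.
apply/eqP; rewrite eq_complex /= hr eqxx /=; move: hi; rewrite ReM /=.
by rewrite mulr0 mulr1 sub0r => /eqP; rewrite oppr_eq0.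
Qed.

(** Mean value theorem along the segment from [q] to [z]. The imaginary part suffices, since the
    real part will be known to vanish. *)
Lemma cdiff0_cst H q rho :
  (forall z, cabs (z - q) < rho -> cdiff H z 0) ->
  forall z, cabs (z - q) < rho -> complex.Im (H z) = complex.Im (H q).
Proof.
move=> dH z zr.
pose pt (t : R) := q + (t%:C)%C * (z - q).
pose u t := complex.Im (H (pt t)).
have inD (t : R) : 0 <= t <= 1 -> cabs (pt t - q) < rho.
  move=> ht; rewrite /pt addrC addKr cabsM cabs_real; apply: le_lt_trans zr.
  by rewrite ler_piMl ?cabs_ge0 // ler_norml; lra.
have du (t : R) : 0 <= t <= 1 -> is_derive t 1 u 0.
  move=> /inD/dH dt; apply: approx_is_derive => e e0.
  pose M := cabs (z - q) + 1.
  have M0 : 0 < M by rewrite /M; have := cabs_ge0 (z - q); lra.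
  have [s s0 hs] := dt _ (divr_gt0 e0 M0).
  exists (s / M) => [|k hk]; first exact: divr_gt0.
  have ck : cabs ((k%:C)%C * (z - q)) <= `|k| * M.
    by rewrite cabsM cabs_real ler_wpM2l // /M; lra.
  have := hs ((k%:C)%C * (z - q)); rewrite ltr_pdivlMr // in hk.
  move=> /(_ (le_lt_trans ck hk)).
  have -> : pt t + (k%:C)%C * (z - q) = pt (t + k).
    by rewrite /pt rmorphD /=; ring.
  rewrite !mul0r !subr0 => hb; rewrite /u -ImB.
  apply: le_trans (normIm_le _) _; apply: le_trans hb _.
  by rewrite mulrAC ler_pdivrMr // -mulrA ler_pM2l.
have [c _] : exists2 c : R, c \in `[0, 1]%R & u 1 - u 0 = 0 * (1 - 0).
  apply: (@MVT_segment R u (fun=> 0)) => //.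
    by move=> t; rewrite in_itv /= => ht; apply: du; lra.
  apply: cont_on_within => t /du ht.
  by apply: differentiable_continuous; apply/derivable1_diffP.
rewrite mul0r /u /pt => /eqP; rewrite subr_eq0 => /eqP.
by rewrite mul1r subrKC mul0r addr0.
Qed.

(** Near [q] the derivative of [H] is 0, so [H - H q] vanishes there and hence on the whole disk;
    the constant [H q] is purely imaginary. *)
Lemma Re_disk_continuation H q r rho : 0 < rho ->
  (forall z, cabs (z - q) < r -> exists d, cdiff H z d) ->
  (forall z, cabs (z - q) < rho -> complex.Re (H z) = 0) ->
  forall z, cabs (z - q) < r -> complex.Re (H z) = 0.
Proof.
move=> rho0 dH H0 z zr.
have r0 : 0 < r by apply: le_lt_trans zr; exact: cabs_ge0.
pose s := Num.min r rho.
have s0 : 0 < s by rewrite lt_min r0.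
have sr : s <= r by rewrite ge_min lexx.
have srho : s <= rho by rewrite ge_min lexx orbT.
clearbody s.
have dH0 v : cabs (v - q) < s -> cdiff H v 0.
  move=> vs; have [|d hd] := dH v; first exact: lt_le_trans sr.
  suff <- : d = 0 by [].
  apply: (@cdiff_Re0 _ _ _ (s - cabs (v - q))) hd _; first by rewrite subr_gt0.
  move=> h hh; apply: H0; apply: lt_le_trans srho.
  have -> : v + h - q = (v - q) + h by ring.
  by apply: le_lt_trans (cabsD _ _) _; lra.
have Hq : complex.Re (H q) = 0 by apply: H0; rewrite subrr cabs0.
have : H z - H q = 0.
  apply: (@disk_continuation (fun v => H v - H q) q r s) => // v vr.
    have [d hd] := dH v vr; exists (d - 0).
    by apply: cdiffB => //; exact: cdiff_cst.
  have vI := cdiff0_cst dH0 vr; apply/eqP; rewrite subr_eq0 eq_complex vI eqxx.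
  by rewrite andbT Hq H0 //; exact: lt_le_trans srho.
by move=> /eqP; rewrite subr_eq0 => /eqP ->.
Qed.

End Identity.

(** * The principal logarithm *)

Section Logarithm.
Context {R : realType}.
Local Notation C := R[i].
Implicit Types (z h : C).

Lemma cabs_ge_Re z (m : R) : m <= complex.Re z -> m <= cabs z.
Proof. by move=> /le_trans; apply; exact: le_trans (ler_norm _) (normRe_le _). Qed.

Lemma cdiff_inv z : z != 0 -> exists d, cdiff (fun w => w^-1) z d.
Proof.
move=> z0; exists (- (z ^- 2)) => e e0.
have cz : 0 < cabs z by rewrite cabs_gt0.
(* The remainder is [h ^+ 2 / (z ^+ 2 * (z + h))], and [z + h] keeps at least half the modulus of
   [z]. *)
pose M := cabs z ^- 3 * 2.
have M0 : 0 < M by rewrite mulr_gt0 // invr_gt0 exprn_gt0.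
exists (Num.min (cabs z / 2) (e / M)).
  by rewrite lt_min !divr_gt0.
move=> h; rewrite lt_min => /andP[h1 h2].
have zh : cabs z / 2 <= cabs (z + h).
  have := cabsB (z + h) h; rewrite addrK; lra.
have zh0 : z + h != 0 by rewrite -cabs_gt0; lra.
have -> : (z + h)^-1 - z^-1 - - (z ^- 2) * h = h * (h / (z ^+ 2 * (z + h))).
  by field; rewrite z0 zh0.
rewrite cabsM mulrC ler_wpM2r ?cabs_ge0 // cabsM cabsV.
apply: le_trans (_ : e / M * M <= _); last by rewrite divfK // lt0r_neq0.
apply: ler_pM; rewrite ?cabs_ge0 ?invr_ge0 ?cabs_ge0 //; first exact: ltW.
rewrite cabsM expr2 cabsM /M.
have -> : cabs z ^- 3 * 2 = (cabs z * cabs z * (cabs z / 2))^-1.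
  by field; rewrite lt0r_neq0.
rewrite lef_pV2 ?posrE; last 2 first.
- by rewrite !mulr_gt0 // lt0r cabs_eq0 cabs_ge0 zh0.
- by rewrite !mulr_gt0.
by rewrite ler_pM2l // mulr_gt0.
Qed.

(** The arctangent of the slope is the argument only in the right half-plane, so derivatives are
    taken only there. *)
Definition clog z : C := ((ln (complex.Re z ^+ 2 + complex.Im z ^+ 2) / 2) +i*
  (atan (complex.Im z / complex.Re z)))%C.

Lemma Re_clog z : z != 0 -> complex.Re (clog z) = ln (cabs z).
Proof.
rewrite -cabs_gt0 => z0; rewrite /clog /= -cabs_sqr lnXn //.
by rewrite -[_ *+ 2]mulr_natr mulfK.
Qed.

(** Along a real line the complex logarithm reduces to one-variable calculus for [ln] and [atan]. *)
Lemma is_derive_clog z h (t : R) : 0 < complex.Re (z + (t%:C)%C * h) ->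
  is_derive t 1 (fun s => complex.Re (clog (z + (s%:C)%C * h)))
    (complex.Re (h / (z + (t%:C)%C * h))) /\
  is_derive t 1 (fun s => complex.Im (clog (z + (s%:C)%C * h)))
    (complex.Im (h / (z + (t%:C)%C * h))).
Proof.
case: z => x y; case: h => a b.
have wE (s : R) : (x +i* y)%C + (s%:C)%C * (a +i* b)%C =
    ((x + s * a) +i* (y + s * b))%C.
  by apply/eqP; rewrite eq_complex /= !mul0r subr0 addr0 !eqxx.
have -> : (fun s => complex.Re (clog ((x +i* y)%C + (s%:C)%C * (a +i* b)%C))) =
    (fun s => ln ((x + s * a) ^+ 2 + (y + s * b) ^+ 2) / 2).
  by apply/funext => s; rewrite wE.
have -> : (fun s => complex.Im (clog ((x +i* y)%C + (s%:C)%C * (a +i* b)%C))) =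
    (fun s => atan ((y + s * b) / (x + s * a))).
  by apply/funext => s; rewrite wE.
rewrite wE /= => X0.
have scE (u v : R) : u *: v = u * v by [].
have dlin (u v : R) : is_derive t 1 (fun s => u + s * v) v.
  apply: approx_is_derive => e e0; exists 1 => // k _.
  have -> : u + (t + k) * v - (u + t * v) - v * k = 0 by ring.
  by rewrite normr0 mulr_ge0 // ltW.
set X := x + t * a in X0 *; set Y := y + t * b.
have X0' := lt0r_neq0 X0.
have n0 : 0 < X ^+ 2 + Y ^+ 2 by rewrite ltr_wpDr ?sqr_ge0 // exprn_gt0.
have n0' := lt0r_neq0 n0.
split.
  have dn : is_derive t 1 (fun s => (x + s * a) ^+ 2 + (y + s * b) ^+ 2)
      (2 * (a * X + b * Y)).
    apply: approx_is_derive => e e0; pose M := a ^+ 2 + b ^+ 2 + 1.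
    have M0 : 0 < M by rewrite /M ltr_wpDl // addr_ge0 // sqr_ge0.
    exists (e / M) => [|k hk]; first exact: divr_gt0.
    rewrite [X in `|X|](_ : _ = k * (k * (a ^+ 2 + b ^+ 2))); last first.
      by rewrite /X /Y; ring.
    rewrite normrM mulrC ler_wpM2r // normrM.
    apply: (@le_trans _ _ (`|k| * M)); last by rewrite -ler_pdivlMr // ltW.
    by rewrite ler_wpM2l // ger0_norm ?addr_ge0 ?sqr_ge0 // /M lerDl.
  have dl := @is_derive1_comp R (@ln R)
    (fun s => (x + s * a) ^+ 2 + (y + s * b) ^+ 2) t _ _ (is_derive1_ln n0) dn.
  have half : is_derive (ln (X ^+ 2 + Y ^+ 2)) 1 (fun v : R => v / 2) 2^-1.
    apply: approx_is_derive => e e0; exists 1 => // k _.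
    rewrite [X in `|X|](_ : _ = 0); last by ring.
    by rewrite normr0 mulr_ge0 // ltW.
  have := @is_derive1_comp R (fun v => v / 2)
    (@ln R \o (fun s => (x + s * a) ^+ 2 + (y + s * b) ^+ 2)) t _ _ half dl.
  rewrite /comp => /is_derive_eq; apply.
  rewrite /X /Y in n0' *; set n := _ + _ in n0' *.
  by field.
have dV := @is_deriveV R (fun s => x + s * a) t _ _ X0' (dlin x a).
have dM := @is_deriveM R R (fun s : R => y + s * b)
  (fun s : R => (x + s * a)^-1) t 1 _ _
  (dlin y b) dV.
have := @is_derive1_comp R (@atan R) (fun s => (y + s * b) / (x + s * a)) t _ _
  (is_derive1_atan _) dM.
rewrite /comp => /is_derive_eq; apply.
rewrite !scE -/X -/Y.
by field; rewrite n0' X0'.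
Qed.

(** Where the real part is at least [1 / 4], inverses have modulus at most 4, so the derivative
    along the segment varies by at most [16 * cabs h ^+ 2]. The mean value theorem, applied to each
    of the two parts, doubles this. The constant is independent of [z], so the estimate can be
    integrated over the torus. *)
Lemma clog_estimate z h : 1 / 4 <= complex.Re z -> 1 / 4 <= complex.Re (z + h) ->
  cabs (clog (z + h) - clog z - h / z) <= 32 * cabs h ^+ 2.
Proof.
move=> z4 zh4; pose w (t : R) := z + (t%:C)%C * h.
have w4 (t : R) : 0 <= t <= 1 -> 1 / 4 <= complex.Re (w t).
  by move: z4 zh4; rewrite /w !ReD ReZ => *; nra.
have w0 : w 0 = z by rewrite /w mul0r addr0.
have w1 : w 1 = z + h by rewrite /w mul1r.
have nz (v : C) : 1 / 4 <= complex.Re v -> v != 0.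
  by move=> /cabs_ge_Re h4; rewrite -cabs_gt0; lra.
have dw (t : R) : 0 <= t <= 1 -> cabs (h / w t - h / z) <= 16 * cabs h ^+ 2.
  move=> ht; have h4 := w4 t ht.
  have -> : h / w t - h / z = - (t%:C)%C * (h * h) * ((w t)^-1 * z^-1).
    have := nz _ z4; have := nz _ h4; rewrite /w => u1 u2.
    by field; rewrite u1 u2.
  rewrite !cabsM cabsN cabs_real !cabsV -expr2.
  have i1 (v : C) : 1 / 4 <= complex.Re v -> 0 <= (cabs v)^-1 <= 4.
    move=> /cabs_ge_Re v4; rewrite invr_ge0 cabs_ge0 /=.
    have -> : 4 = (1 / 4 : R)^-1 by field.
    by rewrite lef_pV2 ?posrE //; lra.
  have /andP[a0 a4] := i1 _ z4; have /andP[b0 b4] := i1 _ h4.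
  rewrite mulrC; apply: ler_pM; rewrite ?mulr_ge0 ?cabs_ge0 //.
    by apply: le_trans (ler_pM b0 a0 b4 a4) _; lra.
  rewrite ler_piMl ?sqr_ge0 // ler_norml; lra.
have part (u u' : R -> R) (m : R) :
    (forall t : R, 0 <= t <= 1 -> is_derive t 1 u (u' t)) ->
    (forall t : R, 0 <= t <= 1 -> `|u' t - m| <= 16 * cabs h ^+ 2) ->
    `|u 1 - u 0 - m| <= 16 * cabs h ^+ 2.
  move=> du hu; have [|| c c01 ->]  := @MVT_segment R u u' 0 1 ler01.
  - by move=> t; rewrite in_itv /= => ht; apply: du; lra.
  - apply: cont_on_within => t /du ht.
    by apply: differentiable_continuous; apply/derivable1_diffP.
  - by rewrite subr0 mulr1; apply: hu; move: c01; rewrite in_itv.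
have A1 : `|complex.Re (clog (w 1)) - complex.Re (clog (w 0)) -
    complex.Re (h / z)| <= 16 * cabs h ^+ 2.
  apply: (part (fun t => complex.Re (clog (w t))) (fun t => complex.Re (h / w t))).
    move=> t /w4 ht; have [|? _] := @is_derive_clog z h t; rewrite -/(w t) //.
    lra.
  by move=> t /dw; apply: le_trans; rewrite -ReB; exact: normRe_le.
have A2 : `|complex.Im (clog (w 1)) - complex.Im (clog (w 0)) -
    complex.Im (h / z)| <= 16 * cabs h ^+ 2.
  apply: (part (fun t => complex.Im (clog (w t))) (fun t => complex.Im (h / w t))).
    move=> t /w4 ht; have [|_ ?] := @is_derive_clog z h t; rewrite -/(w t) //.
    lra.
  by move=> t /dw; apply: le_trans; rewrite -ImB; exact: normIm_le.
rewrite w0 w1 in A1 A2.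
by apply: le_trans (cabs_le _) _; rewrite !ReB !ImB; lra.
Qed.

Lemma cdiff_clog z : 1 / 2 <= complex.Re z -> cdiff clog z z^-1.
Proof.
move=> z2 e e0; exists (Num.min (1 / 4) (e / 32)).
  by rewrite lt_min; apply/andP; split; lra.
move=> h; rewrite lt_min => /andP[h1 h2].
have := normRe_le h; rewrite ler_norml => hR.
have := @clog_estimate z h; rewrite ReD => /(_ ltac:(lra) ltac:(lra)) H.
rewrite [z^-1 * h]mulrC; apply: le_trans H _.
by rewrite expr2 mulrA ler_wpM2r ?cabs_ge0 //; lra.
Qed.

(** The bound [32 * (1 / 4) + 1 / 2], rounded up; it serves only to get integrability. *)
Lemma clog_bounded h : cabs h <= 1 / 2 -> cabs (clog (1 + h)) <= 9.
Proof.
move=> h2; have := normRe_le h; rewrite ler_norml => hR.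
have := @clog_estimate 1 h; rewrite ReD /= => /(_ ltac:(lra) ltac:(lra)).
have -> : clog 1 = 0.
  by rewrite /clog /= expr0n expr1n /= addr0 ln1 !mul0r atan0.
rewrite subr0 divr1 => H.
have -> : clog (1 + h) = (clog (1 + h) - h) + h by rewrite subrK.
apply: le_trans (cabsD _ _) _.
have : cabs h ^+ 2 <= 1 / 4.
  by have := cabs_ge0 h; rewrite expr2; nra.
lra.
Qed.
End Logarithm.

(** * Integrals over the torus *)

Section ComplexIntegral.
Context {d : measure_display} {X : measurableType d} {R : realType}.
Variables (mu : probability X R) (D : set X).
Hypothesis mD : measurable D.
Local Notation C := R[i].
Implicit Types (f g k : X -> C) (u : X -> R).

Definition cintegrable f :=
  mu.-integrable D (EFin \o (fun x => complex.Re (f x))) /\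
  mu.-integrable D (EFin \o (fun x => complex.Im (f x))).

Definition cint f : C := ((\int[mu]_(x in D) complex.Re (f x)) +i*
  (\int[mu]_(x in D) complex.Im (f x)))%C.

Lemma Rintegral_bounded u K : mu.-integrable D (EFin \o u) ->
  (forall x, D x -> `|u x| <= K) -> `|\int[mu]_(x in D) u x| <= `|K|.
Proof.
move=> iu uK; apply: le_trans (le_normr_Rintegral _ _) _ => //.
have iK : mu.-integrable D (EFin \o cst `|K|).
  exact: finite_measure_integrable_cst.
apply: le_trans (_ : _ <= \int[mu]_(x in D) `|K|) _.
  apply: le_Rintegral => //; first exact: integrable_norm iu.
  by move=> x /uK/le_trans; apply; exact: ler_norm.
rewrite Rintegral_cst // ler_piMr //.
have mD1 := probability_le1 mu mD.
by rewrite -[leRHS]/(fine 1%E) fine_le // fin_num_measure.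
Qed.

Lemma integrable_lin2 (a b : R) (u v : X -> R) :
  mu.-integrable D (EFin \o u) -> mu.-integrable D (EFin \o v) ->
  mu.-integrable D (EFin \o (fun x => a * u x + b * v x)) /\
  \int[mu]_(x in D) (a * u x + b * v x) =
    a * \int[mu]_(x in D) u x + b * \int[mu]_(x in D) v x.
Proof.
move=> iu iv.
have au : mu.-integrable D (EFin \o (fun x => a * u x)).
  exact: (integrableZl mD a iu).
have bv : mu.-integrable D (EFin \o (fun x => b * v x)).
  exact: (integrableZl mD b iv).
split; first exact: (integrableD mD au bv).
by rewrite RintegralD // !RintegralZl.
Qed.

(** Differentiation under the integral sign in increment form: a uniform bound on the remainders
    passes to the integrals because the total mass is at most 1. The factor 2 comes from treating
    real and imaginary parts separately. *)
Lemma cint_remainder f g k (h : C) (K : R) :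
  cintegrable f -> cintegrable g -> cintegrable k -> 0 <= K ->
  (forall x, D x -> cabs (f x - g x - h * k x) <= K) ->
  cabs (cint f - cint g - h * cint k) <= 2 * K.
Proof.
move=> [rf jf] [rg jg] [rk jk] K0 H.
case: h H => a b H.
have lin (u v w z : X -> R) (s t : R) : mu.-integrable D (EFin \o u) ->
    mu.-integrable D (EFin \o v) -> mu.-integrable D (EFin \o w) ->
    mu.-integrable D (EFin \o z) ->
    (forall x, D x -> `|u x - v x - (s * w x + t * z x)| <= K) ->
    `|\int[mu]_(x in D) u x - \int[mu]_(x in D) v x -
      (s * \int[mu]_(x in D) w x + t * \int[mu]_(x in D) z x)| <= K.
  move=> iu iv iw iz hK; have [i1 e1] := integrable_lin2 1 (-1) iu iv.
  have [i2 e2] := integrable_lin2 s t iw iz.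
  have [i3 e3] := integrable_lin2 1 (-1) i1 i2.
  have := @Rintegral_bounded _ K i3; rewrite e3 e1 e2 (ger0_norm K0) !mul1r !mulN1r.
  by apply => x Dx; rewrite !mul1r !mulN1r; exact: hK.
apply: le_trans (cabs_le _) _; rewrite !ReB !ImB ReM ImM /=.
have -> : 2 * K = K + K by ring.
apply: lerD.
  rewrite -mulNr; apply: lin => // x Dx; apply: le_trans (H x Dx).
  by apply: le_trans (normRe_le _); rewrite !ReB ReM /= mulNr.
apply: lin => // x Dx; apply: le_trans (H x Dx).
by apply: le_trans (normIm_le _); rewrite !ImB ImM.
Qed.

End ComplexIntegral.

(** * Continuity and measurability on the torus *)

Section Torus.
Context {R : realType} {n : nat}.
Local Notation C := R[i].
Implicit Types (f g : 'rV[C]_n -> C) (x y : 'rV[C]_n) (v : C -> C).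

Definition ccont f x := forall e : R, 0 < e -> nbhs x [set y | cabs (f y - f x) < e].

Lemma ccont_cst (a : C) x : ccont (fun=> a) x.
Proof. by move=> e e0; apply: filterE => y /=; rewrite subrr cabs0. Qed.

Lemma ccont_coord j x : ccont (fun y => y 0 j) x.
Proof.
move=> e e0; apply/nbhs_ballP; exists (e%:C)%C; first by rewrite /= ltcR.
by move=> y [_ /(_ 0 j)] /cabs_ball; rewrite cabsBC.
Qed.

Lemma ccontD f g x : ccont f x -> ccont g x -> ccont (fun y => f y + g y) x.
Proof.
move=> cf cg e e0; have e2 : 0 < e / 2 by lra.
apply: filterS2 (cf _ e2) (cg _ e2) => y /= h1 h2.
have -> : f y + g y - (f x + g x) = (f y - f x) + (g y - g x) by ring.
by apply: le_lt_trans (cabsD _ _) _; lra.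
Qed.

Lemma ccont_comp v f x : ccont f x -> (exists d, cdiff v (f x) d) ->
  ccont (v \o f) x.
Proof.
move=> cf [d /cdiff_lip[r r0 hr]] e e0.
pose M := cabs d + 1; have M0 : 0 < M by rewrite /M; have := cabs_ge0 d; lra.
have m0 : 0 < Num.min r (e / M) by rewrite lt_min r0 divr_gt0.
apply: filterS (cf _ m0) => y /=; rewrite lt_min => /andP[h1 h2].
have := hr _ h1; rewrite subrKC => /le_lt_trans; apply.
by rewrite mulrC -ltr_pdivlMr.
Qed.

(** Polarization again: sums and squares are enough. *)
Lemma ccontM f g x : ccont f x -> ccont g x -> ccont (fun y => f y * g y) x.
Proof.
move=> cf cg.
have cZ (a : C) h : ccont h x -> ccont (fun y => a * h y) x.
  move=> ch; apply: (@ccont_comp (fun w => a * w)) => //.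
  by exists (a * 1); apply: cdiffZ; exact: cdiff_id.
have cS h : ccont h x -> ccont (fun y => h y * h y) x.
  move=> ch; apply: (@ccont_comp (fun w => w * w)) => //.
  by exists (2 * h x); exact: cdiff_sqr.
have := cZ (4^-1) _ (ccontD (cS _ (ccontD cf cg))
  (cZ (-1) _ (cS _ (ccontD cf (cZ (-1) _ cg))))).
by congr ccont; apply/funext => y; field.
Qed.

Lemma cdiff_expz (k : int) (z : C) : z != 0 -> exists d, cdiff (fun w => w ^ k) z d.
Proof.
move=> z0.
have pos (m : nat) : exists d, cdiff (fun w : C => w ^+ m) z d.
  elim: m => [|m [d hd]].
    by exists 0; under eq_fun do rewrite expr0; exact: cdiff_cst.
  exists (1 * z ^+ m + z * d); under eq_fun do rewrite exprS.
  exact: (@cdiffM _ (fun w => w) (fun w => w ^+ m) z 1 d (@cdiff_id _ z) hd).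
case: k => m; first exact: pos.
have [d hd] := pos m.+1.
have [d' hd'] := @cdiff_inv _ (z ^+ m.+1) (expf_neq0 _ z0).
by exists (d' * d); exact: (@cdiff_comp _ (fun w : C => w ^+ m.+1) (fun w => w^-1)).
Qed.

Lemma torus_neq0 x j : torus x -> x 0 j != 0.
Proof. by move=> /(_ j) h; rewrite -normr_eq0 h oner_eq0. Qed.

Lemma ccont_laurent (P : laurent C n) x : torus x -> ccont (laurent_eval P) x.
Proof.
move=> Tx; rewrite /laurent_eval.
elim: (finsupp P : seq _) => [|k s IH].
  by under eq_fun do rewrite big_nil; exact: ccont_cst.
under eq_fun do rewrite big_cons; apply: ccontD => //.
apply: ccontM; first exact: ccont_cst.
elim: (index_enum _) => [|j t IHt].
  by under eq_fun do rewrite big_nil; exact: ccont_cst.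
under eq_fun do rewrite big_cons; apply: ccontM => //.
apply: (@ccont_comp (fun w => w ^ k 0 j)); first exact: ccont_coord.
exact/cdiff_expz/torus_neq0.
Qed.

(** The complement is open: a coordinate off the unit circle stays off it nearby. *)
Lemma measurable_torus : measurable (@torus R n : set (borelC R n)).
Proof.
rewrite -(setCK (@torus R n : set (borelC R n))); apply: measurableC; apply: sub_sigma_algebra.
rewrite openE => x /= nT.
have [j hj] : exists j, `|x 0 j| != 1.
  apply: contrapT => h; apply: nT => j.
  by apply/eqP/negPn/negP => hj; apply: h; exists j.
have hj' : cabs (x 0 j) != 1.
  by apply: contraNneq hj => h; rewrite normc_cabs h.
pose e := `|cabs (x 0 j) - 1|.
have e0 : 0 < e by rewrite normr_gt0 subr_eq0.
change (nbhs (x : 'rV[C]_n) (~` (@torus R n))).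
have hc := @ccont_coord j x e e0.
apply: (filterS _ hc) => y /= hy Ty.
have y1 : cabs (y 0 j) = 1 by apply: (@complexI R); rewrite -normc_cabs Ty.
move: hy; rewrite ltNge => /negP; apply; rewrite /e -y1 distrC.
exact: ler_cabs_dist.
Qed.

(** Continuity is known only at points of the torus, so the preimage of an interval need not be
    open; its interior is, and meets the torus in the same set. *)
Lemma measurable_fun_torus (u : borelC R n -> R) :
  (forall x : 'rV[C]_n, torus x -> forall e, 0 < e ->
     nbhs x [set y | `|u y - u x| < e]) ->
  measurable_fun (@torus R n : set (borelC R n)) u.
Proof.
move=> cu; apply: (measurability _ (measurable_realfun.RGenOpens.measurableE R)).
move=> _ [_ [a [b ->]] <-].
have -> : (@torus R n : set (borelC R n)) `&` u @^-1` `]a, b[ =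
    (@torus R n : set (borelC R n)) `&`
    (interior (u @^-1` `]a, b[ : set 'rV[C]_n) : set (borelC R n)).
  apply/seteqP; split=> x [Tx ux]; split=> //; last exact: interior_subset ux.
  move: ux; rewrite /= in_itv /= => /andP[ax xb].
  have e0 : 0 < Num.min (u x - a) (b - u x) by rewrite lt_min !subr_gt0 ax.
  change (nbhs (x : 'rV[C]_n) (u @^-1` `]a, b[)).
  apply: filterS (cu x Tx _ e0) => y /=; rewrite lt_min in_itv /= !ltr_norml.
  lra.
apply: measurableI; first exact: measurable_torus.
by apply: sub_sigma_algebra; exact: open_interior.
Qed.

End Torus.

(** * The Mahler measure as a local real part *)

Section Potential.
Context {R : realType} {n : nat}.
Local Notation C := R[i].
Variables (mu : probability (borelC R n) R) (P : laurent C n).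
Implicit Types (s h c : C) (v : C -> C).
Local Notation T := (@torus R n : set (borelC R n)).
Local Notation A := (laurent_eval P : borelC R n -> C).

Lemma measurable_comp_laurent v :
  (forall x : 'rV[C]_n, torus x -> exists d, cdiff v (A x) d) ->
  measurable_fun T (fun x => complex.Re (v (A x))) /\
  measurable_fun T (fun x => complex.Im (v (A x))).
Proof.
move=> dv.
have cv (x : 'rV[C]_n) : torus x -> ccont (v \o A) x.
  by move=> Tx; apply: ccont_comp; [exact: ccont_laurent|exact: dv].
split; apply: measurable_fun_torus => x Tx e e0.
  apply: (filterS _ (cv x Tx e e0)) => y /=; apply: le_lt_trans.
  by rewrite -ReB normRe_le.
apply: (filterS _ (cv x Tx e e0)) => y /=; apply: le_lt_trans.
by rewrite -ImB normIm_le.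
Qed.

Lemma cintegrable_comp_laurent v (K : R) :
  (forall x : 'rV[C]_n, torus x -> exists d, cdiff v (A x) d) ->
  (forall x : 'rV[C]_n, torus x -> cabs (v (A x)) <= K) ->
  cintegrable mu T (v \o A).
Proof.
move=> /measurable_comp_laurent[mR mI] vK.
have fin : (mu T < +oo)%E.
  by rewrite ltey_eq fin_num_measure //; exact: measurable_torus.
split; apply: measurable_bounded_integrable => //; try exact: measurable_torus.
  exists K; split=> [|M KM x Tx]; first exact: num_real.
  by apply: le_trans (normRe_le _) _; apply: le_trans (vK x Tx) (ltW KM).
exists K; split=> [|M KM x Tx]; first exact: num_real.
by apply: le_trans (normIm_le _) _; apply: le_trans (vK x Tx) (ltW KM).
Qed.

Lemma mahler_lnE c : (forall x : 'rV[C]_n, torus x -> A x + c != 0) ->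
  mahler mu (laurent_addC P c) = (\int[mu]_(x in T) (ln (cabs (A x + c)))%:E)%E.
Proof.
move=> Pc; apply: eq_integral => x /set_mem Tx.
by rewrite laurent_eval_addC lne_EFin // cabs_gt0 Pc.
Qed.

Definition log_ratio c s (a : C) : C := clog (1 + s * (a + c)^-1).

(* [Phi s] is the integral of [Log (1 + s / (P + c))] over the torus. *)
Lemma mahler_local c (del : R) : 0 < del ->
  (forall x : 'rV[C]_n, torus x -> 2 * del <= cabs (A x + c)) ->
  mahler mu (laurent_addC P c) \is a fin_num ->
  exists Phi : C -> C, forall s, cabs s < del ->
    (exists d, cdiff Phi s d) /\
    fine (mahler mu (laurent_addC P (c + s))) =
    fine (mahler mu (laurent_addC P c)) + complex.Re (Phi s).
Proof.
move=> del0 Ac fin.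
have Ac0 (x : 'rV[C]_n) : torus x -> A x + c != 0.
  by move=> /Ac h; rewrite -cabs_gt0; lra.
have small s (x : 'rV[C]_n) : torus x -> cabs (s * (A x + c)^-1) <= cabs s / (2 * del).
  move=> Tx; rewrite cabsM cabsV ler_wpM2l ?cabs_ge0 //.
  by rewrite lef_pV2 ?posrE ?Ac ?cabs_gt0 ?Ac0 // mulr_gt0.
(* The factor 2 in the lower bound on [P + c] keeps [1 + s / (P + c)] in the region where [clog] is
   under control. *)
have half s (x : 'rV[C]_n) : cabs s < del -> torus x ->
    cabs (s * (A x + c)^-1) <= 1 / 2.
  move=> sd /(small s) /le_trans; apply.
  by rewrite ler_pdivrMr ?mulr_gt0 //; lra.
have Re_half s (x : 'rV[C]_n) : cabs s < del -> torus x ->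
    1 / 2 <= complex.Re (1 + s * (A x + c)^-1).
  move=> sd Tx; have := le_trans (normRe_le _) (half s x sd Tx).
  by rewrite ReD ler_norml /=; lra.
pose Phi s := cint mu T (log_ratio c s \o A).
have iL s : cabs s < del -> cintegrable mu T (log_ratio c s \o A).
  move=> sd; apply: (@cintegrable_comp_laurent _ 9) => x Tx; last first.
    exact: clog_bounded (half s x sd Tx).
  have [d hd] := cdiff_inv (Ac0 x Tx).
  have h1 := @cdiff_comp R (fun a => a + c) (fun a => a^-1) (A x) _ d
    (cdiffD (cdiff_id (A x)) (cdiff_cst c (A x))) hd.
  have h2 := cdiffD (cdiff_cst 1 (A x)) (cdiffZ s h1).
  eexists; exact: (@cdiff_comp R (fun a => 1 + s * (a + c)^-1) (@clog R) (A x)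
    _ _ h2 (cdiff_clog (Re_half s x sd Tx))).
have lower s (x : 'rV[C]_n) : cabs s < del -> torus x -> del <= cabs (A x + c + s).
  move=> sd Tx; have := Ac x Tx; have := cabsB (A x + c + s) s.
  by rewrite addrK; lra.
(* [1 / (a + c + s)] is the derivative in [s] of [Log (1 + s / (a + c))]; its integral will be the
   derivative of [Phi]. *)
have iD s : cabs s < del -> cintegrable mu T ((fun a => (a + c + s)^-1) \o A).
  move=> sd; apply: (@cintegrable_comp_laurent _ del^-1) => x Tx.
    have [|d hd] := @cdiff_inv _ (A x + c + s).
      by rewrite -cabs_gt0; have := lower s x sd Tx; lra.
    have h1 := cdiffD (cdiffD (cdiff_id (A x)) (cdiff_cst c (A x)))
      (cdiff_cst s (A x)).
    eexists; exact: (@cdiff_comp R (fun a => a + c + s) (fun a => a^-1) (A x)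
      _ d h1 hd).
  rewrite cabsV lef_pV2 ?posrE ?lower // cabs_gt0 -cabs_gt0.
  by have := lower s x sd Tx; lra.
exists Phi => s sd; split.
  exists (cint mu T ((fun a => (a + c + s)^-1) \o A)) => e e0.
  (* The first bound keeps [s + h] in the disk. The second absorbs the integrated remainder, twice
     [32 * (cabs h / (2 * del)) ^+ 2]. *)
  exists (Num.min (del - cabs s) (e * del ^+ 2 / 16)).
    by rewrite lt_min subr_gt0 sd divr_gt0 // mulr_gt0 // exprn_gt0.
  move=> h; rewrite lt_min => /andP[h1 h2].
  have shd : cabs (s + h) < del by apply: le_lt_trans (cabsD _ _) _; lra.
  rewrite mulrC; apply: le_trans.
    apply: (@cint_remainder _ _ _ mu T measurable_torus _ _ _ h
      (8 * cabs h ^+ 2 / del ^+ 2) (iL _ shd) (iL _ sd) (iD _ sd)).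
      by rewrite divr_ge0 ?sqr_ge0 // mulr_ge0 ?sqr_ge0.
    move=> x Tx; rewrite /comp /log_ratio.
    set u := A x + c; have u0 : u != 0 := Ac0 x Tx.
    have us0 : u + s != 0.
      by rewrite -cabs_gt0; have := lower s x sd Tx; rewrite -/u; lra.
    have -> : 1 + (s + h) * u^-1 = (1 + s * u^-1) + h * u^-1 by ring.
    have -> : h * (u + s)^-1 = h * u^-1 / (1 + s * u^-1).
      by field; rewrite u0 us0.
    apply: le_trans (clog_estimate _ _) _.
    - by have := Re_half s x sd Tx; rewrite -/u; lra.
    - have := Re_half _ x shd Tx; rewrite -/u.
      have -> : 1 + (s + h) * u^-1 = (1 + s * u^-1) + h * u^-1 by ring.
      lra.
    have hx := small h x Tx; rewrite -/u in hx.
    have -> : 8 * cabs h ^+ 2 / del ^+ 2 = 32 * (cabs h / (2 * del)) ^+ 2.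
      by field; rewrite lt0r_neq0.
    rewrite ler_pM2l // ler_sqr ?nnegrE ?cabs_ge0 //.
    by rewrite divr_ge0 ?cabs_ge0 // mulr_ge0 // ltW.
  have d2 : 0 < del ^+ 2 by rewrite exprn_gt0.
  have -> : 2 * (8 * cabs h ^+ 2 / del ^+ 2) = 16 * cabs h / del ^+ 2 * cabs h.
    by ring.
  rewrite ler_wpM2r ?cabs_ge0 // ler_pdivrMr //; lra.
rewrite !mahler_lnE //; last first.
  move=> x Tx; rewrite addrA -cabs_gt0; have := lower s x sd Tx; lra.
have mln : measurable_fun T (fun x => ln (cabs (A x + c))).
  apply: measurable_fun_torus => x Tx e e0.
  have cx : 0 < cabs (A x + c) by rewrite cabs_gt0 Ac0.
  have /cvgrPdist_lt/(_ _ e0) := continuous_ln cx.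
  move=> /nbhs_ballP[r /= r0 hr].
  have cA : ccont (fun y => A y + c) x.
    by apply: ccontD; [exact: ccont_laurent|exact: ccont_cst].
  apply: filterS (cA r r0) => y /= hy.
  rewrite distrC; apply: hr; rewrite /ball /= distrC.
  by apply: le_lt_trans hy; exact: ler_cabs_dist.
(* A measurable real function with finite integral is integrable, so this follows from the
   finiteness of the Mahler measure at [c]. *)
have iln : mu.-integrable T (EFin \o (fun x => ln (cabs (A x + c)))).
  apply/integrableP; split; first exact/measurable_realfun.measurable_EFinP.
  rewrite integral_fin_num_abs //; last exact: measurable_torus.
  by rewrite -mahler_lnE.
rewrite -RintegralD //; [|exact: measurable_torus|by have [] := iL s sd].
apply: eq_Rintegral => x /set_mem Tx; rewrite /comp /log_ratio Re_clog; last first.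
  by rewrite -cabs_gt0; have := cabs_ge_Re (Re_half s x sd Tx); lra.
have u0 := Ac0 x Tx.
rewrite -lnM ?posrE ?cabs_gt0 //; last first.
  by rewrite -cabs_gt0; have := cabs_ge_Re (Re_half s x sd Tx); lra.
by rewrite -cabsM; congr (ln (cabs _)); field.
Qed.

End Potential.

(** * Continuation across the components of [V] *)

(** Supplies the function to be continued: [nu * (m + Phi (c tau - c p)) - E tau] is holomorphic
    near [p], with real part [F - G]. *)
Lemma harmonic_difference (R : realType) (n : nat)
  (mu : probability (borelC R n) R) (P : laurent R[i] n)
  (hP : admissible mu P) (K : set R[i]) (hK : critical_image P K)
  (c E : R[i] -> R[i]) (hc : holomorphic_on (@upper_half_plane R) c)
  (hE : holomorphic_on (@upper_half_plane R) E) (nu : R) (p : R[i]) :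
  upper_half_plane p -> ~ K (c p) ->
  exists (r : R) (H : R[i] -> R[i]), 0 < r /\ forall tau, cabs (tau - p) < r ->
    [/\ upper_half_plane tau, exists d, cdiff H tau d &
      complex.Re (H tau) = nu * fine (mahler mu (laurent_addC P (c tau))) -
        complex.Re (E tau)].
Proof.
move=> up nK; have [clK subK] := hK; have [finP _] := hP.
have : nbhs (c p) (~` K) by apply: open_nbhs_nbhs; split=> //; exact: closed_openC.
move=> /nbhs_cabsP[e e0 he].
(* The disk of radius [e] around [c p] misses [K], hence every [- P x] with [x] on the torus; so
   [P + c p] has modulus at least [e] there. *)
have [||Phi hPhi] := @mahler_local R n mu P (c p) (e / 2) _ _ (finP (c p)).
- lra.
- move=> x Tx; rewrite leNgt; apply/negP => h.
  apply: (he (- laurent_eval P x)); last by apply: subK; exists x.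
  by rewrite opprK addrC; lra.
have [dp hdp] := derivable_cdiff (hc _ up).
have [r1 r10 h1] := cdiff_lip hdp.
pose M := cabs dp + 1; have M0 : 0 < M by rewrite /M; have := cabs_ge0 dp; lra.
(* The last two bounds keep [c tau] within [e / 2] of [c p], and [tau] in the upper half-plane. *)
pose r := Num.min r1 (Num.min (e / 2 / M) (complex.Im p)).
have r0 : 0 < r.
  by rewrite !lt_min r10 up andbT divr_gt0 //; lra.
pose m := fine (mahler mu (laurent_addC P (c p))).
exists r, (fun tau => ((nu%:C)%C * ((m%:C)%C + Phi (c tau - c p))) - E tau).
split=> // tau; rewrite !lt_min => /and3P[k1 k2 k3].
have ut : upper_half_plane tau.
  have := le_lt_trans (normIm_le _) k3; rewrite ImB ltr_norml.
  by rewrite /upper_half_plane /=; lra.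
have sd : cabs (c tau - c p) < e / 2.
  have := h1 _ k1; rewrite subrKC => /le_lt_trans; apply.
  by rewrite mulrC -ltr_pdivlMr.
have [[d hd] hm] := hPhi _ sd.
have [dt hdt] := derivable_cdiff (hc _ ut); have [dE hdE] := derivable_cdiff (hE _ ut).
split=> //.
  have g1 := @cdiff_comp R (fun t => c t - c p) Phi tau _ d
    (cdiffB hdt (cdiff_cst (c p) tau)) hd.
  have g2 := cdiffZ (nu%:C)%C (cdiffD (cdiff_cst (m%:C)%C tau) g1).
  by eexists; exact: (cdiffB g2 hdE).
rewrite ReB ReZ ReD; congr (nu * _ - _).
by move: hm; rewrite subrKC => ->.
Qed.

Theorem theorem2p10 (R : realType) (n : nat)
  (mu : probability (borelC R n) R) (hmu : normalized_haar mu)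
  (P : laurent R[i] n) (hP : admissible mu P)
  (K : set R[i]) (hK : critical_image P K)
  (c : R[i] -> R[i]) (hc : holomorphic_on (@upper_half_plane R) c)
  (V : set R[i])
  (hV : V = [set tau | upper_half_plane tau /\ ~ K (c tau)])
  (nu : R) (hnu : 0 < nu)
  (F : R[i] -> R)
  (hF : forall tau, upper_half_plane tau ->
    F tau = nu * fine (mahler mu (laurent_addC P (c tau))))
  (E : R[i] -> R[i]) (hE : holomorphic_on (@upper_half_plane R) E)
  (G : R[i] -> R)
  (hG : forall tau, upper_half_plane tau -> G tau = complex.Re (E tau))
  (W : set R[i]) (hW : exists2 w, V w & W = connected_component V w)
  (hFG : exists U : set R[i], [/\ open U, U !=set0, U `<=` W &
    forall tau, U tau -> F tau = G tau]) :
  forall tau, closure W tau -> upper_half_plane tau -> F tau = G tau.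
Proof.
pose Z : set R[i] := [set z | F z = G z].
have [w Vw WE] := hW.
have WV : W `<=` V by rewrite WE; exact: connected_component_sub.
have Wup tau : W tau -> upper_half_plane tau by move=> /WV; rewrite hV => -[].
have WZ : W = W `&` interior Z.
  apply/esym; have cW : connected W by rewrite WE; exact: component_connected.
  apply: cW.
  - have [U [oU [u Uu] UW FGU]] := hFG.
    exists u; split; first exact: UW.
    by apply: (filterS FGU); exact: open_nbhs_nbhs.
  - by exists (interior Z) => //; exact: open_interior.
  (* With this closed set as witness, it remains to see that a point [p] of [W] adherent to the
     interior of [Z] belongs to that interior. *)
  exists (closure (interior Z)); first exact: closed_closure.
  apply/seteqP; split=> p [Wp Zp]; split=> //; first exact: subset_closure.
  have up := Wup p Wp.
  have nK : ~ K (c p) by move: (WV p Wp); rewrite hV => -[].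
  have [r [H [r0 hH]]] := @harmonic_difference R n mu P hP K hK c E hc hE nu p up nK.
  (* For [q] within [r / 2] of [p], the disk of radius [r / 2] around [q] contains [p] and stays in
     the disk of radius [r] around [p], where [H] is available. *)
  have r2 : 0 < r / 2 by lra.
  have nb : nbhs p [set z | cabs (p - z) < r / 2].
    by apply/nbhs_cabsP; exists (r / 2).
  have [q [Zq /= pq]] := Zp _ nb.
  have in_r z : cabs (z - q) < r / 2 -> cabs (z - p) < r.
    move=> zq; have -> : z - p = (z - q) - (p - q) by ring.
    by apply: le_lt_trans (cabsB _ _) _; lra.
  have Re_eq z : cabs (z - q) < r / 2 -> complex.Re (H z) = F z - G z.
    by move=> /in_r/hH[uz _ ->]; rewrite hF // hG.
  have [rho rho0 hrho] := (nbhs_cabsP _ _).1 Zq.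
  pose rho' := Num.min rho (r / 2).
  have rho'0 : 0 < rho' by rewrite lt_min rho0.
  have FG z : cabs (z - q) < r / 2 -> F z = G z.
    move=> zq; apply/eqP; rewrite -subr_eq0 -Re_eq //; apply/eqP.
    apply: (@Re_disk_continuation R H q (r / 2) rho') => // v.
      by move=> /in_r/hH[].
    rewrite lt_min => /andP[v1 v2]; rewrite Re_eq //.
    have -> : F v = G v by apply: hrho; rewrite cabsBC.
    by rewrite subrr.
  apply/nbhs_cabsP; exists (r / 2 - cabs (p - q)); first by rewrite subr_gt0.
  move=> z pz; apply: FG; have -> : z - q = (z - p) + (p - q) by ring.
  by apply: le_lt_trans (cabsD _ _) _; rewrite [cabs (z - p)]cabsBC; lra.
have FGW z : W z -> F z = G z by rewrite WZ => -[_ /interior_subset].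
(* At such a [tau], [c tau] may lie in [K], where no local holomorphic function is at hand.
   Continuity is used instead: [c] is continuous at [tau], and the Mahler measure is continuous on
   the whole plane. Nearby points of [W] then contradict a positive gap, of which [e] is half. *)
move=> tau clW ut; apply/eqP/negP => /negP neq.
pose e := `|F tau - G tau| / 2.
have e0 : 0 < e by rewrite divr_gt0 // normr_gt0 subr_eq0.
have [finP contP] := hP.
have [dc /cdiff_lip[r1 r10 h1]] := derivable_cdiff (hc _ ut).
have [dE /cdiff_lip[r2 r20 h2]] := derivable_cdiff (hE _ ut).
have nf : 0 < e / nu by rewrite divr_gt0.
have /cvgrPdist_lt/(_ _ nf)/nbhs_cabsP[r3 r30 h3] := contP (c tau).
pose M := cabs dc + 1; have M0 : 0 < M by rewrite /M; have := cabs_ge0 dc; lra.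
pose M' := cabs dE + 1; have M0' : 0 < M' by rewrite /M'; have := cabs_ge0 dE; lra.
pose r := Num.min (Num.min r1 (r3 / M)) (Num.min r2 (e / M')).
have r0 : 0 < r.
  by rewrite !lt_min r10 r20 /=; apply/andP; split; exact: divr_gt0.
have nb : nbhs tau [set z | cabs (tau - z) < r] by apply/nbhs_cabsP; exists r.
have [z [Wz /= tz]] := clW _ nb.
have uz := Wup z Wz.
move: tz; rewrite cabsBC !lt_min => /andP[/andP[k1 k2] /andP[k3 k4]].
have Fz : `|F tau - F z| < e.
  rewrite !hF // -mulrBr normrM gtr0_norm // mulrC -ltr_pdivlMr //.
  apply: h3; rewrite cabsBC; have := h1 _ k1; rewrite subrKC => /le_lt_trans; apply.
  by rewrite mulrC -ltr_pdivlMr.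
have Gz : `|G tau - G z| < e.
  rewrite !hG // -ReB; apply: le_lt_trans (normRe_le _) _; rewrite cabsBC.
  have := h2 _ k3; rewrite subrKC => /le_lt_trans; apply.
  by rewrite mulrC -ltr_pdivlMr.
have : `|F tau - G tau| < e + e.
  have -> : F tau - G tau = (F tau - F z) - (G tau - G z) by rewrite (FGW z Wz); ring.
  by apply: le_lt_trans (ler_normB _ _) _; exact: ltrD.
by rewrite /e -mulrDr -[X in _ * X]mulr2n -[_ *+ 2]mulr_natr mulVf ?mulr1 ?ltxx.
Qed.
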